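(* Let $W$ and $W'$ be finite Coxeter groups (with fixed sets $S$ and $S'$ of simple generators). A surjective lattice homomorphism from the weak order on $W$ to the weak order on $W'$ is determined by its restrictions to rank-two standard parabolic subgroups; that is, if two surjective lattice homomorphisms $W\to W'$ agree on $W_{\{r,s\}}$ for every pair of distinct elements $r,s\in S$, then they are equal.
   Context: For a finite Coxeter system $(W,S)$ with length function $\ell$, the (right) weak order on $W$ is the lattice whose cover relations are $w\lessdot ws$ for $w\in W$, $s\in S$ with $\ell(w)<\ell(ws)$. A lattice homomorphism preserves pairwise meets and joins. For $J\subseteq S$, $W_J$ is the standard parabolic subgroup generated by $J$; it has rank two if $|J|=2$. *)

(* Defs.v *)
From mathcomp Require Import all_boot all_fingroup.

Set Implicit Arguments.
Unset Strict Implicit.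
Unset Printing Implicit Defensive.

Local Open Scope group_scope.

(* (W, S) is a Coxeter system, W being the whole type: the elements of S have
   order 2, and W has the presentation < S | (s t)^m(s,t) = 1 >, where m(s,t)
   is the order of s t in W. The presentation is expressed by its universal
   property among all groups, finite or not; s = t gives the relation s^2 = 1.
   The map phi is only relevant on S. *)
Definition coxeter_system (W : finGroupType) (S : {set W}) : Prop :=
  [/\ <<S>> = [set: W],
      {in S, forall s, #[s] = 2}
    & forall (H : groupType) (phi : W -> H),
        {in S &, forall s t, (phi s * phi t) ^+ #[s * t] = 1} ->
        exists2 psi : W -> H,
          {morph psi : x y / x * y} & {in S, psi =1 phi}].

Section WeakOrder.

Variables (W : finGroupType) (S : {set W}).

(* S ^+ n is the setwise power: the set of products of n elements of S. *)
Lemma cox_length_subproof (w : W) :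
  exists n, (w \in <<S>>) ==> (w \in S ^+ n).
Proof.
have [/gen_prodgP [n [c Sc ->]]|] := boolP (w \in <<S>>); last by exists 0.
exists n => /=; rewrite -[n in S ^+ n]card_ord -prodg_const.
exact: mem_prodg.
Qed.

(* The value 0 outside <<S>> is irrelevant, since S generates W in a Coxeter
   system; inverses are not needed since S consists of involutions. *)
Definition cox_length (w : W) : nat := ex_minn (cox_length_subproof w).

Definition weak_cover : rel W :=
  fun w v =>
    [exists s in S, (v == w * s) && (cox_length w < cox_length (w * s))].

Definition weak_le : rel W := connect weak_cover.

Definition is_meet (x y m : W) : Prop :=
  [/\ weak_le m x, weak_le m y
    & forall z, weak_le z x -> weak_le z y -> weak_le z m].

Definition is_join (x y j : W) : Prop :=
  [/\ weak_le x j, weak_le y j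
    & forall z, weak_le x z -> weak_le y z -> weak_le j z].

End WeakOrder.

(* The weak order on a finite Coxeter group is a lattice, so that every pair
   has exactly one meet and one join; the operations are used through their
   graphs so that no proof of this fact is needed to state preservation. *)
Definition weak_lattice_hom (W W' : finGroupType) (S : {set W}) (S' : {set W'})
    (f : W -> W') : Prop :=
  (forall x y m, is_meet S x y m -> is_meet S' (f x) (f y) (f m)) /\
  (forall x y j, is_join S x y j -> is_join S' (f x) (f y) (f j)).

Definition surjective (A B : Type) (f : A -> B) : Prop :=
  forall y, exists x, f x = y.

(* Main.v *)
(** The weak order on [W] is generated, as a lattice, by its rank-two standard
    parabolic subgroups; two homomorphisms that agree on those therefore agree
    everywhere, as the elements on which they agree form a sublattice.

    If [u] is the minimal element of [u W_J], left multiplication by [u] carries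
    the weak order of [W_J] onto an interval of [W] and preserves joins and meets.
    By induction on the length of [u], every coset [u W_{a,b}] is generated: if
    [r] is a descent of [u], then [u W_{a,b}] lies in a coset of [W_{a,b,r}] whose
    minimal element is shorter. This reduces the claim to rank three, where
    counting elements by their ascents gives 1/x + 1/y + 1/z = 1 + 4/|W_J| for the
    three orders of products of generators. So either one generator commutes with
    the two others, and [p c] is the join of [p] and [c], or [W_J] is of type A3,
    B3 or H3. In these three cases an explicit sequence of joins and meets is
    checked by computation on the Cayley graph. *)

Require Import Defs.
From mathcomp Require Import all_boot all_fingroup.
From mathcomp Require Import zify.

Set Implicit Arguments.
Unset Strict Implicit.
Unset Printing Implicit Defensive.

(** * Cayley graphs of rank three *)

Section CayleyCheck.

Variables (T : seq (seq nat)) (M : nat -> nat -> nat).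

Definition step i a := nth 0 (nth [::] T i) a.

Definition run i d := foldl step i d.

(** In a row of length three without a descent, [find] returns 3, which the test [a < 3] of
    [braid_ok] rejects. *)
Definition first_descent i := find (fun j => j < i) (nth [::] T i).

(* [k] is fuel; any [k > i] gives the same reduced word of [i]. *)
Fixpoint state_word k i : seq nat :=
  if k is k'.+1 then
    if i == 0 then [::]
    else rcons (state_word k' (step i (first_descent i))) (first_descent i)
  else [::].

Fixpoint alternate i a b m := if m is m'.+1 then alternate (step i a) b a m' else i.

Fixpoint descending i a b m :=
  if m is m'.+1 then (step i a < i) && descending (step i a) b a m' else true.

(* Two descents [a], [b] of [i] span a polygon below [i]: descending along its two
   sides for [M a b] steps must lead to the same state. *)
Definition braid_ok i :=
  let a := first_descent i in
  [&& a < 3, step i a < i & all (fun b => (step i b < i) && (b != a) ==>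
    [&& 0 < M a b, descending i a b (M a b), descending i b a (M a b)
      & alternate i a b (M a b) == alternate i b a (M a b)]) (iota 0 3)].

Definition state_words := [seq state_word (size T) i | i <- iota 0 (size T)].

(** The first check makes each generator a fixed-point-free involution of the states; its last
    clause will bound word lengths from below. State 0 has no descent, so the polygons start at
    1. *)
Definition cayley_ok (lev : seq nat) :=
  all (fun i => all (fun a => let j := step i a in
    [&& j < size T, step j a == i, j != i & nth 0 lev j <= (nth 0 lev i).+1])
      (iota 0 3)) (iota 0 (size T))
  && all braid_ok (iota 1 (size T).-1).

(** The prefix form of the weak order, l(w') = l(w) + l(w^-1 w'): reading [rev w] from state 0 leads
    to the inverse of [w], and reading [w'] from there leads to w^-1 w'. *)
Definition order_matrix (words : seq (seq nat)) (lev : seq nat) : seq bitseq :=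
  [seq (let v := run 0 (rev w) in
        [seq size w' == size w + nth 0 lev (run v w') | w' <- words])
  | w <- words].

Definition transposed (A : seq bitseq) : seq bitseq :=
  [seq [seq nth false r i | r <- A] | i <- iota 0 (size T)].

(* [A] is the order matrix (for a join) or its transpose (for a meet). *)
Definition bound_ok (A : seq bitseq) i j k :=
  let ri := nth [::] A i in let rj := nth [::] A j in let rk := nth [::] A k in
  [&& nth false ri k, nth false rj k
    & all (fun p => p.1.1 && p.1.2 ==> p.2) (zip (zip ri rj) rk)].

Fixpoint steps_ok (A At : seq bitseq) (known : seq nat)
    (steps : seq (bool * (nat * nat * nat))) :=
  if steps is (b, (i, j, k)) :: steps' then
    [&& i \in known, j \in known, k < size T, bound_ok (if b then A else At) i j k
      & steps_ok A At (k :: known) steps']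
  else all (fun i => i \in known) (iota 0 (size T)).

(** A state word that omits a letter spells an element of a rank-two parabolic subgroup. *)
Definition rank2_states (words : seq (seq nat)) :=
  [seq i <- iota 0 (size T) |
    has (fun a => a \notin nth [::] words i) (iota 0 3)].

Definition generation_ok steps :=
  let words := state_words in let lev := [seq size w | w <- words] in
  let A := order_matrix words lev in
  [&& 0 < size T, cayley_ok lev
    & steps_ok A (transposed A) (rank2_states words) steps].

End CayleyCheck.

(* The Coxeter matrix of the path diagram [0 -3- 1 -m- 2]. *)
Definition path_matrix m a b :=
  if a == b then 1 else
  match a + b with 1 => 3 | 2 => 2 | _ => m end.

(* Rows are indexed by the elements of the group in breadth-first order from the
   identity [0], so that descents are the edges to a smaller index; row [i] lists
   the right multiples of [i] by the three generators. Nothing is assumed about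
   these tables: [generation_ok] checks what is needed. In a list of steps,
   [(true, (i, j, k))] makes [k] the join of [i] and [j], [(false, (i, j, k))]
   their meet. *)
Definition A3_cayley : seq (seq nat) :=
  [:: [:: 1; 2; 3]; [:: 0; 4; 5]; [:: 6; 0; 7]; [:: 5; 8; 0]; [:: 9; 1; 10];
      [:: 3; 11; 1]; [:: 2; 9; 12]; [:: 12; 13; 2]; [:: 14; 3; 13];
      [:: 4; 6; 15]; [:: 15; 16; 4]; [:: 17; 5; 16]; [:: 7; 18; 6];
      [:: 19; 7; 8]; [:: 8; 17; 19]; [:: 10; 20; 9]; [:: 21; 10; 11];
      [:: 11; 14; 21]; [:: 22; 12; 20]; [:: 13; 22; 14]; [:: 23; 15; 18];
      [:: 16; 23; 17]; [:: 18; 19; 23]; [:: 20; 21; 22]].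

Definition A3_steps : seq (bool * (nat * nat * nat)) :=
  [:: (true, (1, 7, 20)); (true, (1, 8, 17)); (true, (1, 13, 23));
      (true, (3, 4, 16)); (true, (3, 6, 22)); (true, (4, 8, 21));
      (true, (6, 7, 12)); (false, (16, 17, 11)); (false, (16, 20, 10));
      (false, (17, 22, 14)); (false, (20, 22, 18)); (true, (2, 10, 15));
      (true, (2, 14, 19))].

Definition B3_cayley : seq (seq nat) :=
  [:: [:: 1; 2; 3]; [:: 0; 4; 5]; [:: 6; 0; 7]; [:: 5; 8; 0]; [:: 9; 1; 10];
      [:: 3; 11; 1]; [:: 2; 9; 12]; [:: 12; 13; 2]; [:: 14; 3; 15];
      [:: 4; 6; 16]; [:: 16; 17; 4]; [:: 18; 5; 19]; [:: 7; 20; 6];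
      [:: 21; 7; 22]; [:: 8; 18; 23]; [:: 23; 22; 8]; [:: 10; 24; 9];
      [:: 25; 10; 26]; [:: 11; 14; 27]; [:: 27; 26; 11]; [:: 28; 12; 29];
      [:: 13; 28; 30]; [:: 30; 15; 13]; [:: 15; 31; 14]; [:: 32; 16; 33];
      [:: 17; 32; 34]; [:: 34; 19; 17]; [:: 19; 35; 18]; [:: 20; 21; 36];
      [:: 36; 33; 20]; [:: 22; 37; 21]; [:: 37; 23; 38]; [:: 24; 25; 39];
      [:: 39; 29; 24]; [:: 26; 40; 25]; [:: 40; 27; 41]; [:: 29; 42; 28];
      [:: 31; 30; 43]; [:: 43; 41; 31]; [:: 33; 44; 32]; [:: 35; 34; 45];
      [:: 45; 38; 35]; [:: 44; 36; 46]; [:: 38; 46; 37]; [:: 42; 39; 47];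
      [:: 41; 47; 40]; [:: 47; 43; 42]; [:: 46; 45; 44]].

Definition B3_steps : seq (bool * (nat * nat * nat)) :=
  [:: (true, (1, 7, 33)); (true, (1, 8, 18)); (true, (1, 13, 44));
      (true, (1, 15, 41)); (true, (1, 22, 47)); (true, (3, 4, 26));
      (true, (3, 6, 46)); (true, (4, 8, 40)); (true, (4, 15, 45));
      (true, (6, 7, 12)); (true, (6, 13, 28)); (false, (18, 26, 11));
      (false, (18, 46, 14)); (false, (26, 33, 10)); (false, (26, 41, 19));
      (false, (26, 44, 17)); (false, (28, 33, 20)); (false, (33, 46, 29));
      (false, (40, 41, 35)); (false, (40, 44, 25)); (false, (41, 46, 38));
      (false, (44, 46, 42)); (true, (2, 10, 16)); (true, (2, 14, 37));
      (true, (2, 17, 32)); (true, (2, 38, 43)); (true, (3, 25, 34));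
      (true, (7, 17, 39)); (true, (8, 19, 27)); (true, (13, 29, 36));
      (true, (14, 15, 23)); (false, (28, 37, 21)); (false, (32, 33, 24));
      (false, (37, 38, 31)); (true, (3, 21, 30))].

Definition H3_cayley : seq (seq nat) :=
  [:: [:: 1; 2; 3]; [:: 0; 4; 5]; [:: 6; 0; 7]; [:: 5; 8; 0]; [:: 9; 1; 10];
      [:: 3; 11; 1]; [:: 2; 9; 12]; [:: 12; 13; 2]; [:: 14; 3; 15];
      [:: 4; 6; 16]; [:: 16; 17; 4]; [:: 18; 5; 19]; [:: 7; 20; 6];
      [:: 21; 7; 22]; [:: 8; 18; 23]; [:: 23; 24; 8]; [:: 10; 25; 9];
      [:: 26; 10; 27]; [:: 11; 14; 28]; [:: 28; 29; 11]; [:: 30; 12; 31];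
      [:: 13; 30; 32]; [:: 32; 33; 13]; [:: 15; 34; 14]; [:: 35; 15; 33];
      [:: 36; 16; 37]; [:: 17; 36; 38]; [:: 38; 39; 17]; [:: 19; 40; 18];
      [:: 41; 19; 39]; [:: 20; 21; 42]; [:: 42; 43; 20]; [:: 22; 44; 21];
      [:: 45; 22; 24]; [:: 46; 23; 47]; [:: 24; 46; 45]; [:: 25; 26; 48];
      [:: 48; 49; 25]; [:: 27; 50; 26]; [:: 51; 27; 29]; [:: 52; 28; 53];
      [:: 29; 52; 51]; [:: 31; 54; 30]; [:: 55; 31; 49]; [:: 56; 32; 57];
      [:: 33; 56; 35]; [:: 34; 35; 58]; [:: 58; 59; 34]; [:: 37; 60; 36];
      [:: 61; 37; 43]; [:: 62; 38; 63]; [:: 39; 62; 41]; [:: 40; 41; 64];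
      [:: 64; 65; 40]; [:: 66; 42; 67]; [:: 43; 66; 61]; [:: 44; 45; 68];
      [:: 68; 69; 44]; [:: 47; 70; 46]; [:: 71; 47; 65]; [:: 72; 48; 73];
      [:: 49; 72; 55]; [:: 50; 51; 74]; [:: 74; 75; 50]; [:: 53; 76; 52];
      [:: 77; 53; 59]; [:: 54; 55; 78]; [:: 78; 79; 54]; [:: 57; 80; 56];
      [:: 81; 57; 79]; [:: 82; 58; 83]; [:: 59; 82; 77]; [:: 60; 61; 84];
      [:: 84; 85; 60]; [:: 63; 86; 62]; [:: 87; 63; 85]; [:: 88; 64; 89];
      [:: 65; 88; 71]; [:: 67; 90; 66]; [:: 91; 67; 69]; [:: 92; 68; 93];
      [:: 69; 92; 91]; [:: 70; 71; 94]; [:: 94; 93; 70]; [:: 73; 95; 72];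
      [:: 96; 73; 75]; [:: 97; 74; 98]; [:: 75; 97; 96]; [:: 76; 77; 99];
      [:: 99; 98; 76]; [:: 100; 78; 101]; [:: 79; 100; 81];
      [:: 80; 81; 102]; [:: 102; 83; 80]; [:: 83; 103; 82];
      [:: 104; 84; 105]; [:: 85; 104; 87]; [:: 86; 87; 106];
      [:: 106; 89; 86]; [:: 89; 107; 88]; [:: 90; 91; 108];
      [:: 108; 105; 90]; [:: 93; 109; 92]; [:: 109; 94; 110];
      [:: 95; 96; 111]; [:: 111; 101; 95]; [:: 98; 112; 97];
      [:: 112; 99; 113]; [:: 101; 114; 100]; [:: 103; 102; 115];
      [:: 115; 113; 103]; [:: 105; 116; 104]; [:: 107; 106; 117];
      [:: 117; 110; 107]; [:: 116; 108; 118]; [:: 110; 118; 109];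
      [:: 114; 111; 119]; [:: 113; 119; 112]; [:: 119; 115; 114];
      [:: 118; 117; 116]].

Definition H3_steps : seq (bool * (nat * nat * nat)) :=
  [:: (true, (1, 7, 49)); (true, (1, 8, 18)); (true, (1, 13, 105));
      (true, (1, 15, 65)); (true, (1, 22, 116)); (true, (1, 24, 113));
      (true, (1, 33, 119)); (true, (3, 4, 39)); (true, (3, 6, 118));
      (true, (4, 8, 98)); (true, (4, 15, 112)); (true, (4, 24, 117));
      (true, (6, 7, 12)); (true, (6, 13, 30)); (true, (6, 22, 79));
      (false, (18, 39, 11)); (false, (18, 118, 14)); (false, (30, 49, 20));
      (false, (39, 49, 10)); (false, (39, 65, 19)); (false, (39, 105, 17));
      (false, (39, 113, 29)); (false, (39, 116, 27)); (false, (49, 79, 31));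
      (false, (49, 118, 43)); (false, (65, 98, 53)); (false, (65, 118, 59));
      (false, (79, 105, 67)); (false, (98, 105, 26));
      (false, (98, 113, 89)); (false, (98, 116, 63));
      (false, (105, 118, 101)); (false, (112, 113, 107));
      (false, (112, 116, 87)); (false, (112, 118, 71));
      (false, (113, 118, 110)); (false, (116, 118, 114));
      (true, (1, 71, 77)); (true, (2, 10, 16)); (true, (2, 14, 93));
      (true, (2, 17, 36)); (true, (2, 27, 85)); (true, (2, 59, 109));
      (true, (2, 87, 96)); (true, (2, 110, 115)); (true, (3, 26, 62));
      (true, (3, 63, 74)); (true, (3, 87, 97)); (true, (7, 17, 72));
      (true, (7, 27, 104)); (true, (8, 19, 28)); (true, (8, 29, 52));
      (true, (8, 87, 106)); (true, (13, 27, 111)); (true, (13, 31, 42));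
      (true, (13, 43, 66)); (true, (14, 15, 23)); (true, (14, 24, 46));
      (true, (15, 29, 88)); (true, (15, 89, 99)); (true, (22, 43, 100));
      (true, (22, 101, 108)); (true, (24, 59, 82)); (true, (26, 27, 38));
      (true, (29, 53, 64)); (true, (43, 67, 78)); (false, (30, 93, 21));
      (false, (36, 49, 25)); (false, (46, 59, 34)); (false, (49, 85, 37));
      (false, (52, 53, 40)); (false, (52, 62, 41)); (false, (59, 93, 47));
      (false, (62, 63, 50)); (false, (66, 67, 54)); (false, (66, 72, 55));
      (false, (72, 85, 60)); (false, (79, 93, 57)); (false, (79, 109, 69));
      (false, (82, 93, 70)); (false, (85, 87, 75)); (false, (85, 105, 73));
      (false, (88, 89, 76)); (false, (93, 110, 83)); (false, (97, 98, 86));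
      (false, (100, 101, 90)); (false, (100, 109, 81));
      (false, (104, 105, 95)); (false, (109, 110, 103));
      (true, (1, 55, 61)); (true, (3, 21, 56)); (true, (3, 57, 68));
      (true, (3, 69, 92)); (true, (4, 41, 51)); (true, (6, 81, 91));
      (true, (7, 73, 84)); (true, (14, 69, 102)); (true, (17, 37, 48));
      (true, (21, 22, 32)); (true, (24, 47, 58)); (true, (59, 83, 94));
      (false, (46, 56, 35)); (false, (56, 57, 44)); (false, (92, 93, 80));
      (true, (2, 35, 45))].

Lemma A3_ok : generation_ok A3_cayley (path_matrix 3) A3_steps.
Proof. by vm_compute. Qed.

Lemma B3_ok : generation_ok B3_cayley (path_matrix 4) B3_steps.
Proof. by vm_compute. Qed.

Lemma H3_ok : generation_ok H3_cayley (path_matrix 5) H3_steps.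
Proof. by vm_compute. Qed.

(** * Possible orders in rank three *)

(* [g + 4 = 2 (p + q + r)] reads [1/x + 1/y + 1/z = 1 + 4/g]. *)
Lemma coxeter_triple_sorted x y z g p q r : 1 < x -> x <= y -> y <= z -> 0 < g ->
    g + 4 = 2 * (p + q + r) -> 2 * x * p = g -> 2 * y * q = g -> 2 * z * r = g ->
  x = 2 /\ (y = 2 \/ y = 3 /\
    [\/ z = 3 /\ g = 24, z = 4 /\ g = 48 | z = 5 /\ g = 120]).
Proof.
move=> x_gt1 le_xy le_yz g_gt0 euler px qy rz.
(* With all orders at least 3, each of [p], [q], [r] is at most g/6, so their sum is at most g/2,
   against [euler]. The later bounds are alike: g/4 + g/8 + g/8 and g/4 + g/6 + g/12 also equal
   g/2. *)
have x2 : x = 2.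
  have [x_gt2|] := ltnP 2 x; last lia.
  have : 2 * 3 * p <= g by rewrite -px leq_mul2r leq_mul2l x_gt2 !orbT.
  have : 2 * 3 * q <= g by rewrite -qy leq_mul2r leq_mul2l (leq_trans x_gt2) ?orbT.
  have : 2 * 3 * r <= g.
    by rewrite -rz leq_mul2r leq_mul2l (leq_trans x_gt2) ?orbT // (leq_trans le_xy).
  lia.
split=> //; rewrite {}x2 in le_xy px.
have [y_gt3|y_le3] := ltnP 3 y.
  have : 2 * 4 * q <= g by rewrite -qy leq_mul2r leq_mul2l y_gt3 !orbT.
  have : 2 * 4 * r <= g.
    by rewrite -rz leq_mul2r leq_mul2l (leq_trans y_gt3) ?orbT.
  lia.
have [|y3] : y = 2 \/ y = 3 by lia.
  by left.
right; split=> //; rewrite {}y3 in le_yz qy.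
have [z_gt5|z_le5] := ltnP 5 z.
  have : 2 * 6 * r <= g by rewrite -rz leq_mul2r leq_mul2l z_gt5 !orbT.
  lia.
have [z3|[z4|z5]] : z = 3 \/ z = 4 \/ z = 5 by lia.
- by constructor 1; rewrite z3 in rz; lia.
- by constructor 2; rewrite z4 in rz; lia.
by constructor 3; rewrite z5 in rz; lia.
Qed.

(** * Length and the exchange condition *)

Local Open Scope group_scope.

Definition wprod (W : finGroupType) (c : seq W) : W := \prod_(s <- c) s.

Lemma wprod_cons (W : finGroupType) (s : W) c : wprod (s :: c) = s * wprod c.
Proof. by rewrite /wprod big_cons. Qed.

Lemma wprod_cat (W : finGroupType) (c d : seq W) :
  wprod (c ++ d) = wprod c * wprod d.
Proof. by rewrite /wprod big_cat. Qed.

Lemma wprod_rcons (W : finGroupType) (s : W) c :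
  wprod (rcons c s) = wprod c * s.
Proof. by rewrite -cats1 wprod_cat /wprod big_seq1. Qed.

Lemma wprod_nil (W : finGroupType) : wprod [::] = 1 :> W.
Proof. exact: big_nil. Qed.

Lemma wprod_gen (W : finGroupType) (J : {set W}) c :
  all (mem J) c -> wprod c \in <<J>>.
Proof.
elim: c => [|s c IH] /=; first by rewrite wprod_nil group1.
by case/andP=> sJ /IH cJ; rewrite wprod_cons groupM // mem_gen.
Qed.

Lemma gen_wprod (W : finGroupType) (J : {set W}) x :
  x \in <<J>> -> exists2 c, all (mem J) c & x = wprod c.
Proof.
case/gen_prodgP=> n [c Jc ->]; exists [seq c i | i <- index_enum 'I_n].
  by apply/allP => _ /mapP[i _ ->]; apply: Jc.
by rewrite /wprod big_map.
Qed.

Lemma mem_expsetg (W : finGroupType) (J : {set W}) n x :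
  reflect (exists c, [/\ all (mem J) c, size c = n & x = wprod c])
          (x \in J ^+ n).
Proof.
apply: (iffP idP) => [|[c [Jc <- ->]]].
  elim: n x => [|n IH] x.
    by rewrite expg0 => /set1P->; exists [::]; rewrite wprod_nil.
  rewrite expgS => /mulsgP[s y Js /IH[c [Jc <- ->]] ->].
  by exists (s :: c); rewrite /= Js wprod_cons.
elim: c Jc => [|s c IH] /=; first by rewrite wprod_nil expg0 set11.
by case/andP=> Js /IH cJ; rewrite expgS wprod_cons mem_mulg.
Qed.

(** * The signed conjugation action *)

Section SignedConjugation.

Variables (W : finGroupType).

(* [W] acts on signed elements: [s] conjugates, and flips the sign of [s]. *)
Definition sconj (s : W) (p : W * bool) : W * bool :=
  (p.1 ^ s, p.2 (+) (p.1 == s)).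

Lemma sconj_inj s : injective (sconj s).
Proof.
move=> [x e] [y d] [] /= /conjg_inj->.
by case: (_ == _); case: e; case: d.
Qed.

Definition sconj_perm s : {perm (W * bool)} := perm (@sconj_inj s).

(** Each position of [c] has a reflection, namely its letter conjugated by the inverse of the prefix
    before it; this is the parity of the number of positions whose reflection is [x]. *)
Fixpoint flips (c : seq W) (x : W) : bool :=
  if c is s :: c' then (x == s) (+) flips c' (x ^ s) else false.

Lemma sconj_prod c x e :
  (\prod_(s <- c) sconj_perm s) (x, e) = (x ^ wprod c, e (+) flips c x).
Proof.
elim: c x e => [|s c IH] x e.
  by rewrite big_nil perm1 wprod_nil conjg1 addbF.
by rewrite big_cons permM permE /sconj /= IH wprod_cons conjgM addbA.
Qed.

Lemma flipsP c x :
  flips c x -> exists c1 a c2, c = c1 ++ a :: c2 /\ x = a ^ (wprod c1)^-1.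
Proof.
elim: c x => //= s c IH x; have [-> _|_ /=] := eqVneq x s.
  by exists [::], s, c; rewrite wprod_nil invg1 conjg1.
case/IH=> c1 [a [c2 [-> xs]]]; exists (s :: c1), a, c2; split=> //.
by rewrite wprod_cons invMg conjgM -xs conjgK.
Qed.

Lemma sum_period (F : nat -> nat) m : (forall i, F (i + m)%N = F i) ->
  (\sum_(i < m + m) F i)%N = (\sum_(i < m) F i).*2.
Proof.
move=> per; rewrite -addnn big_split_ord /=; congr (_ + _)%N.
by apply: eq_bigr => i _; rewrite addnC per.
Qed.

(** With m the order of s t, the 2m sign tests compare x s with the powers (s t)^i for i < 2m. These
    have period m, so the flips come in pairs and cancel. *)
Lemma sconj_braid (s t : W) : s * s = 1 -> t * t = 1 ->
  (sconj_perm s * sconj_perm t) ^+ #[s * t] = 1.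
Proof.
move=> ss tt; have sV : s^-1 = s by apply/eqP; rewrite eq_invg_mul ss.
have tV : t^-1 = t by apply/eqP; rewrite eq_invg_mul tt.
have stV : (s * t)^-1 = t * s by rewrite invMg sV tV.
have swap k : s * (s * t) ^- k = (s * t) ^+ k * s.
  rewrite -expgVn stV; elim: k => [|k IH]; first by rewrite !expg0 mulg1 mul1g.
  by rewrite expgSr mulgA IH expgSr !mulgA.
(* Conjugating back, the two tests of round k become x s = (s t)^(2k) and x s = (s t)^(2k+1). *)
have step k x e : ((sconj_perm s * sconj_perm t) ^+ k) (x, e) =
    (x ^ ((s * t) ^+ k),
     e (+) odd (\sum_(i < k + k) (x * s == (s * t) ^+ i)%g)).
  elim: k => [|k IH]; first by rewrite !expg0 perm1 conjg1 big_ord0 addbF.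
  rewrite expgSr !permM IH !permE /sconj /= -!conjgM -expgSr.
  congr (_, _); rewrite addSn addnS /= !big_ord_recr /= !oddD -!addbA !oddb.
  do 2 congr (_ (+) _); congr (_ (+) _).
    rewrite -(inj_eq (conjg_inj ((s * t) ^- k))) -conjgM mulgV conjg1.
    rewrite conjgE invgK swap mulgA -expgD.
    by rewrite -(inj_eq (mulIg s)) -mulgA ss mulg1.
  rewrite -(inj_eq (conjg_inj (((s * t) ^+ k * s)^-1))) -conjgM mulgV conjg1.
  rewrite conjgE invgK invMg sV -!mulgA swap -(inj_eq (mulIg s)).
  rewrite -!mulgA ss mulg1 [s * (t * _)]mulgA -expgS -expgD.
  by rewrite addnS.
apply/permP=> -[x e]; rewrite step expg_order conjg1 perm1.
rewrite (sum_period (F := fun i => x * s == (s * t) ^+ i : nat)).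
  by rewrite odd_double addbF.
by move=> i; rewrite expgD expg_order mulg1.
Qed.

End SignedConjugation.

(* Rewriting with [mulgA] changes the canonical instances hidden in products;
   [lia] needs equal lengths to be syntactically equal. *)
Ltac same_product x y :=
  first [ constr_eq x y
        | match x with @monoid.mul _ ?a ?b => match y with @monoid.mul _ ?c ?d =>
            same_product a c; same_product b d end end
        | match x with @monoid.inv _ ?a => match y with @monoid.inv _ ?b =>
            same_product a b end end ].

Ltac cox_lia :=
  repeat match goal with
  | H : context [cox_length _ _] |- _ => revert H
  | H : context [size _] |- _ => revert H
  end;
  repeat match goal with
  | |- context [cox_length ?S ?x] => match goal with
    | |- context [cox_length S ?y] =>
      tryif constr_eq x y then fail else same_product x y;
      change (cox_length S y) with (cox_length S x)
    end
  end;
  repeat match goal with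
  | |- context [cox_length ?S ?x] => generalize (cox_length S x)
  end; clear; lia.

(** * The deletion property and the weak order as a prefix order *)

Section Length.

Variables (W : finGroupType) (S : {set W}).
Hypothesis coxW : coxeter_system S.

Local Notation l := (cox_length S).
Local Notation word J := (all (mem J)).

Implicit Types (s u v w x y z : W) (c d : seq W).

Lemma cox_invol s : s \in S -> s * s = 1.
Proof.
by case: coxW => _ ord2 _ /ord2 os; have := expg_order s; rewrite os expgS expg1.
Qed.

Lemma cox_invV s : s \in S -> s^-1 = s.
Proof. by move=> Ss; apply/eqP; rewrite eq_invg_mul cox_invol. Qed.

Lemma cox_neq1 s : s \in S -> s != 1.
Proof. by case: coxW => _ ord2 _ /ord2; rewrite -order_gt1 => ->. Qed.

Lemma mulsK w s : s \in S -> w * s * s = w.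
Proof. by move=> Ss; rewrite -mulgA cox_invol ?mulg1. Qed.

Lemma wprodV c : word S c -> (wprod c)^-1 = wprod (rev c).
Proof.
elim: c => [|s c IH] /=; first by rewrite wprod_nil invg1.
by case/andP=> Ss Sc; rewrite wprod_cons rev_cons wprod_rcons invMg IH // cox_invV.
Qed.

Lemma cox_gen w : w \in <<S>>.
Proof. by case: coxW => ->; rewrite inE. Qed.

Lemma length_word w : exists c, [/\ word S c, size c = l w & w = wprod c].
Proof.
rewrite /cox_length; case: ex_minnP => n; rewrite cox_gen /= => wn _.
exact/mem_expsetg.
Qed.

Lemma length_le c : word S c -> l (wprod c) <= size c.
Proof.
move=> Sc; rewrite /cox_length; case: ex_minnP => n _; apply.
by rewrite cox_gen; apply/mem_expsetg; exists c.
Qed.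

Lemma length1 : l 1 = 0.
Proof. by apply/eqP; rewrite -leqn0 -(wprod_nil W) length_le. Qed.

Lemma length_eq0 w : l w = 0 -> w = 1.
Proof. by have [[|s c] [_ <- ->] //] := length_word w; rewrite wprod_nil. Qed.

Lemma lengthV w : l w^-1 = l w.
Proof.
suff le u : l u^-1 <= l u by apply/eqP; rewrite eqn_leq le -{1}[w]invgK le.
have [c [Sc <- ->]] := length_word u; rewrite wprodV // -size_rev length_le //.
by rewrite all_rev.
Qed.

Lemma lengthM x y : l (x * y) <= l x + l y.
Proof.
have [c [Sc <- ->]] := length_word x; have [d [Sd <- ->]] := length_word y.
by rewrite -wprod_cat -size_cat length_le // all_cat Sc.
Qed.

Lemma length_gen s : s \in S -> l s = 1%N.
Proof.
move=> Ss; apply/eqP; rewrite eqn_leq.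
have := @length_le [:: s]; rewrite /wprod big_seq1 /= Ss => -> //.
by rewrite lt0n; apply: contraNneq (cox_neq1 Ss) => /length_eq0->.
Qed.

(** The universal property extends the signed conjugations to an action [psi] of [W], so the parity
    [flips] depends only on the product of a word. If [c] flips [s], the letter responsible can be
    deleted. *)
Lemma deletion_left c s : word S c -> s \in S -> l (s * wprod c) <= l (wprod c) ->
  exists c1 a c2, c = c1 ++ a :: c2 /\ s * wprod c = wprod (c1 ++ c2).
Proof.
have [_ _ univ] := coxW; move=> Sc Ss.
have [|psi psiM psiS] := univ _ (@sconj_perm W).
  by move=> a b Sa Sb; rewrite /= sconj_braid ?cox_invol.
have psi_word d : word S d -> psi (wprod d) = \prod_(a <- d) sconj_perm a.
  elim: d => [_|a d IH /=/andP[Sa Sd]]; last first.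
    by rewrite wprod_cons psiM IH // big_cons psiS.
  rewrite wprod_nil big_nil; apply: (mulgI (psi 1)).
  by rewrite -psiM !mulg1.
have flipE d x : word S d -> flips d x = (psi (wprod d) (x, false)).2.
  by move=> Sd; rewrite psi_word // sconj_prod addFb.
have del d : word S d -> flips d s ->
    exists c1 a c2, d = c1 ++ a :: c2 /\ s * wprod d = wprod (c1 ++ c2).
  move=> Sd /flipsP[c1 [a [c2 [d_def sa]]]]; exists c1, a, c2; split=> //.
  have Sa : a \in S by move: Sd; rewrite d_def all_cat /= => /and3P[].
  rewrite d_def sa !wprod_cat wprod_cons conjgE invgK.
  by rewrite -!mulgA mulKg [a * (a * _)]mulgA cox_invol // mul1g.
have [/(del c Sc)//|nf] := boolP (flips c s).
(* Otherwise [s :: c] flips [s], hence so does a reduced word [d] of the same product. Deleting a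
   letter of [d] then spells [wprod c] with fewer letters than the length of [s * wprod c], contrary
   to the hypothesis. *)
have [d [Sd sz_d d_def]] := length_word (s * wprod c).
have : flips d s.
  rewrite flipE // -d_def -[s * wprod c]wprod_cons -flipE /= ?Ss //.
  by rewrite eqxx conjgE mulKg (negbTE nf).
case/(del d Sd)=> d1 [a [d2 [d12 prod_d]]].
have : l (wprod c) <= size (d1 ++ d2).
  rewrite -[wprod c](mulKg s) cox_invV // d_def prod_d length_le //.
  by move: Sd; rewrite d12 !all_cat /= => /and3P[-> _ ->].
rewrite -sz_d d12 !size_cat /=; cox_lia.
Qed.

Lemma deletion c s : word S c -> s \in S -> l (wprod c * s) <= l (wprod c) ->
  exists c1 a c2, c = c1 ++ a :: c2 /\ wprod c * s = wprod (c1 ++ c2).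
Proof.
move=> Sc Ss le; have Src : word S (rev c) by rewrite all_rev.
have eqV : s * wprod (rev c) = (wprod c * s)^-1.
  by rewrite invMg cox_invV // wprodV.
have [|c1 [a [c2 [rc prod_c]]]] := deletion_left Src Ss.
  by rewrite eqV -wprodV // !lengthV.
have c_def : c = rev c2 ++ a :: rev c1.
  by rewrite -[c]revK rc rev_cat rev_cons cat_rcons.
exists (rev c2), a, (rev c1); split=> //.
apply: invg_inj; rewrite -eqV prod_c wprodV ?rev_cat ?revK //.
by move: Sc; rewrite c_def !all_cat /= => /and3P[-> _ ->].
Qed.

(** Lengths differ by at most one. If they were equal, deletion in a reduced word of [w] would give
    a word of [w * s] that is too short. *)
Lemma length_mulsP w s : s \in S ->
  (l (w * s) == (l w).+1) || (l w == (l (w * s)).+1).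
Proof.
move=> Ss; have := lengthM w s; have := lengthM (w * s) s.
rewrite mulsK // (length_gen Ss) => le1 le2.
have neq : l (w * s) != l w; last by cox_lia.
have [c [Sc sz_c w_def]] := length_word w; apply/eqP=> eq_l.
have [|c1 [a [c2 [c_def prod_c]]]] := deletion Sc Ss.
  by rewrite -w_def eq_l.
have S12 : word S (c1 ++ c2).
  by move: Sc; rewrite c_def !all_cat /= => /and3P[-> _ ->].
have := length_le S12; rewrite -prod_c -w_def eq_l -sz_c c_def !size_cat /=; cox_lia.
Qed.

Lemma length_muls_gt w s : s \in S -> (l w < l (w * s)) = (l (w * s) == (l w).+1).
Proof. by move/(length_mulsP w); cox_lia. Qed.

Lemma length_muls_le w s : s \in S -> (l (w * s) <= l w) = (l w == (l (w * s)).+1).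
Proof. by move/(length_mulsP w); cox_lia. Qed.

(** Each cover raises the length by exactly one. Conversely, a reduced word of [x^-1 * y] is read as
    a chain of covers from [x]. *)
Lemma weak_leE x y : weak_le S x y = (l y == l x + l (x^-1 * y)).
Proof.
apply/connectP/eqP=> [[p xp ->]|].
  elim/last_ind: p xp => [|p z IH] /=; first by rewrite mulVg length1 addn0.
  rewrite rcons_path last_rcons => /andP[/IH eq_l /existsP[s]].
  case/and3P=> Ss /eqP-> gt_l; move: (last x p) eq_l gt_l => u eq_l gt_l.
  have := lengthM x (x^-1 * (u * s)); have := lengthM (x^-1 * u) s.
  rewrite mulKVg -mulgA (length_gen Ss).
  by move: gt_l; rewrite length_muls_gt //; cox_lia.
have [c [Sc <- c_def]] := length_word (x^-1 * y).
rewrite -[y](mulKVg x) c_def; move: Sc {c_def}.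
elim/last_ind: c => [_ _|c s IH]; first by exists [::]; rewrite ?wprod_nil ?mulg1.
rewrite all_rcons size_rcons wprod_rcons mulgA => /andP[Ss Sc] eq_l.
have := lengthM x (wprod c); have := lengthM (x * wprod c) s.
have := length_le Sc; rewrite (length_gen Ss) => le1 le2 le3.
have [|p xp last_p] := IH Sc; first cox_lia.
exists (rcons p (x * wprod c * s)); last by rewrite last_rcons.
rewrite rcons_path xp -last_p; apply/existsP; exists s.
by rewrite (Ss : s \in S) eqxx /=; cox_lia.
Qed.

Lemma weak_le_refl x : weak_le S x x.
Proof. exact: connect0. Qed.

Lemma weak_le_trans y x z : weak_le S x y -> weak_le S y z -> weak_le S x z.
Proof. exact: connect_trans. Qed.

Lemma weak_le_anti x y : weak_le S x y -> weak_le S y x -> x = y.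
Proof.
have -> : weak_le S y x = (l x == l y + l (x^-1 * y)).
  by rewrite weak_leE -[l (x^-1 * y)]lengthV invMg invgK.
rewrite weak_leE => le1 le2.
by apply/eqP; rewrite eq_mulVg1; apply/eqP/length_eq0; cox_lia.
Qed.

Lemma is_meet_uniq x y m1 m2 : is_meet S x y m1 -> is_meet S x y m2 -> m1 = m2.
Proof.
by case=> m1x m1y max1 [m2x m2y max2]; apply: weak_le_anti; [apply: max2|apply: max1].
Qed.

Lemma is_join_uniq x y j1 j2 : is_join S x y j1 -> is_join S x y j2 -> j1 = j2.
Proof.
by case=> j1x j1y min1 [j2x j2y min2]; apply: weak_le_anti; [apply: min1|apply: min2].
Qed.

(** * Parabolic cosets *)

Section Parabolic.

Variable J : {set W}.
Hypothesis sJS : J \subset S.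

(** By [ascents_length] below, such a [u] is the minimal element of its coset of [<<J>>]. *)
Definition ascents_in u := {in J, forall s, l u < l (u * s)}.

Lemma word_sub c : word J c -> word S c.
Proof. by apply: sub_all => s; apply: (subsetP sJS). Qed.

(** Deletion removes letters and adds none, so a word in [J] can be shortened to a reduced one
    within [J]: the length on [<<J>>] is the one inherited from [W]. *)
Lemma reduced_word x : x \in <<J>> ->
  exists c, [/\ word J c, size c = l x & x = wprod c].
Proof.
case/gen_wprod=> c Jc ->; elim/last_ind: c Jc => [_|c s IH].
  by exists [::]; rewrite wprod_nil length1.
rewrite all_rcons wprod_rcons => /andP[/= Js /IH[d [Jd sz_d c_def]]] {IH}.
rewrite {}c_def in sz_d *; have Ss := subsetP sJS _ Js.
have [le|gt] := leqP (l (wprod d * s)) (l (wprod d)); last first.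
  exists (rcons d s); rewrite all_rcons wprod_rcons size_rcons /= Js Jd.
  by split=> //; move: gt; rewrite length_muls_gt // => /eqP->; rewrite sz_d.
have [d1 [a [d2 [d_def prod_d]]]] := deletion (word_sub Jd) Ss le.
exists (d1 ++ d2); split=> //.
  by move: Jd; rewrite d_def !all_cat /= => /and3P[-> _ ->].
move: le; rewrite length_muls_le //.
have : size d = (size (d1 ++ d2)).+1 by rewrite d_def !size_cat /= addnS.
by cox_lia.
Qed.

(** Every [x] in [<<J>>] is a suffix of [w]. A reduced word of [x] is moved to the end of a word of
    [w] letter by letter, each time exchanging a letter of the remaining prefix [d]. *)
Lemma descents_length w x : {in J, forall s, l (w * s) <= l w} -> x \in <<J>> ->
  l w = l (w * x^-1) + l x.
Proof.
move=> desc /reduced_word[c [Jc sz_c x_def]]; rewrite {}x_def in sz_c *.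
suff le: l (w * (wprod c)^-1) + size c <= l w.
  have := lengthM (w * (wprod c)^-1) (wprod c); rewrite mulgKV.
  by move: (length_le (word_sub Jc)); cox_lia.
have {sz_c} : size c <= l (wprod c) by rewrite sz_c.
elim/last_ind: c Jc => [_ _|c s IH].
  by rewrite wprod_nil invg1 mulg1 addn0.
rewrite all_rcons size_rcons wprod_rcons => /andP[/= Js Jc] red.
have Ss := subsetP sJS _ Js.
have le : l (w * (wprod c)^-1) + size c <= l w.
  apply: IH => //; have := lengthM (wprod c) s; rewrite (length_gen Ss); cox_lia.
have [d [Sd sz_d d_def]] := length_word (w * (wprod c)^-1).
have w_def : w = wprod (d ++ c) by rewrite wprod_cat -d_def mulgKV.
have Sdc : word S (d ++ c) by rewrite all_cat Sd word_sub.
have := desc s Js; rewrite {1 2}w_def.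
case/(deletion Sdc Ss) => e1 [a [e2 [e_def prod_e]]].
have := congr1 size e_def; rewrite !size_cat /= => sz_e.
have del_word b1 b2 b : word S b -> b = b1 ++ a :: b2 -> word S (b1 ++ b2).
  by move=> Sb b_def; move: Sb; rewrite b_def !all_cat /= => /and3P[-> _ ->].
(* A deleted letter within [c] would make [rcons c s] non-reduced. *)
have [lt_e|le_d] := ltnP (size e1) (size d); last first.
  have c_def : c = drop (size d) e1 ++ a :: e2.
    rewrite -{1}(drop_size_cat c (erefl (size d))) e_def drop_cat.
    by case: ltngtP le_d => // ->; rewrite subnn drop0 drop_size.
  have ed : take (size d) e1 = d.
    rewrite -{2}(take_size_cat c (erefl (size d))) e_def take_cat.
    by case: ltngtP le_d => // ->; rewrite subnn take0 cats0 take_size.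
  have cs : wprod c * s = wprod (drop (size d) e1 ++ e2).
    apply: (mulgI (wprod d)).
    by rewrite mulgA -wprod_cat prod_e -{1}[e1](cat_take_drop (size d)) ed -catA -wprod_cat.
  have := length_le (del_word _ _ _ (word_sub Jc) c_def); rewrite -cs.
  by move: red; have := congr1 size c_def; rewrite !size_cat /=; cox_lia.
(* So the letter lies in [d], and the shortened [d] spells the prefix of [w] that remains before
   [rcons c s]. *)
have d_def' : d = e1 ++ a :: take (size d - (size e1).+1) e2.
  rewrite -{1}(take_size_cat c (erefl (size d))) e_def take_cat ltnNge ltnW //=.
  by rewrite -(subnSK lt_e).
have e2_def : e2 = take (size d - (size e1).+1) e2 ++ c.
  rewrite -{1}[e2](cat_take_drop (size d - (size e1).+1)); congr (_ ++ _).
  rewrite -[RHS](drop_size_cat c (erefl (size d))) e_def drop_cat ltnNge ltnW //=.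
  by rewrite -(subnSK lt_e).
have -> : w * (wprod c * s)^-1 = wprod (e1 ++ take (size d - (size e1).+1) e2).
  rewrite invMg (cox_invV Ss) mulgA {1}w_def prod_e {1}e2_def catA wprod_cat.
  by rewrite -mulgA mulgV mulg1.
have := length_le (del_word _ _ _ Sd d_def').
by have := congr1 size d_def'; rewrite !size_cat /=; cox_lia.
Qed.

(** An element of maximal length in [<<J>>] has every member of [J] as a descent. *)
Lemma longest_exists : exists2 wJ, wJ \in <<J>> &
  {in <<J>>, forall x, l wJ = l (wJ * x) + l x}.
Proof.
have [wJ JwJ max] := arg_maxnP l (group1 <<J>>%G); exists wJ => // x Jx.
rewrite -[x]invgK lengthV; apply: descents_length; rewrite ?groupV // => s Js.
by apply: max; apply: (groupM JwJ (mem_gen Js)).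
Qed.

Lemma ascents_coset w : exists u x, [/\ ascents_in u, x \in <<J>> & w = u * x].
Proof.
have [x Jx min] := arg_minnP (fun x => l (w * x^-1)) (group1 <<J>>%G).
exists (w * x^-1), x; rewrite mulgKV; split=> // s Js.
have Ss := subsetP sJS _ Js; rewrite ltnNge length_muls_le //.
have := min (s * x) (groupM (mem_gen Js) Jx).
by rewrite invMg (cox_invV Ss) mulgA; cox_lia.
Qed.

End Parabolic.

(** Left multiplication by the longest element [w0] complements lengths, turning the ascents of [u]
    into descents of [w0 * u], to which [descents_length] applies. *)
Lemma ascents_length (J : {set W}) u x : J \subset S -> ascents_in J u -> x \in <<J>> ->
  l (u * x) = l u + l x.
Proof.
move=> sJS asc Jx; have [w0 _ max] := longest_exists (subxx S).
have {}max y : l w0 = l (w0 * y) + l y by apply: max; apply: cox_gen.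
have : l (w0 * u) = l (w0 * u * x^-1^-1) + l x^-1.
  apply: (descents_length sJS) => [s Js|]; last by rewrite groupV.
  by have := max u; have := max (u * s); have := asc s Js; rewrite mulgA; cox_lia.
by have := max u; have := max (u * x); rewrite invgK lengthV mulgA; cox_lia.
Qed.

Lemma ascents_weak_le (J : {set W}) u x y : J \subset S -> ascents_in J u ->
  x \in <<J>> -> y \in <<J>> -> weak_le S (u * x) (u * y) = weak_le S x y.
Proof.
move=> sJS asc Jx Jy; rewrite !weak_leE !(ascents_length sJS asc) // invMg.
by rewrite -mulgA mulKg -addnA eqn_add2l.
Qed.

Lemma ascents_le (J : {set W}) u x : J \subset S -> ascents_in J u -> x \in <<J>> ->
  weak_le S u (u * x).
Proof.
by move=> sJS asc Jx; rewrite weak_leE mulKg (ascents_length sJS asc).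
Qed.

(** Factoring [z^-1] through its minimal coset representative writes [z] as [zJ] times a factor
    before which every element of [<<J>>] has additive length. *)
Lemma parabolic_projection (J : {set W}) z : J \subset S ->
  exists zJ, [/\ zJ \in <<J>>, weak_le S zJ z
    & {in <<J>>, forall x, weak_le S x z -> weak_le S x zJ}].
Proof.
move=> sJS; have [u [x [asc Jx zV]]] := ascents_coset sJS z^-1.
have Jx' : x^-1 \in <<J>> by rewrite groupV.
have z_def : z = x^-1 * u^-1 by rewrite -invMg -zV invgK.
have lenJ p : p \in <<J>> -> l (p * u^-1) = l p + l u^-1.
  move=> Jp; rewrite -[l (p * _)]lengthV invMg invgK.
  by rewrite (ascents_length sJS asc) ?groupV // !lengthV addnC.
exists x^-1; split=> // [|p Jp]; rewrite !weak_leE z_def.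
  by rewrite mulKg lenJ.
by rewrite lenJ // mulgA lenJ ?groupM ?groupV // addnA eqn_add2r.
Qed.

(** * Transport of joins and meets to cosets *)

Definition join_in (J : {set W}) x y j :=
  [/\ weak_le S x j, weak_le S y j
    & {in <<J>>, forall z, weak_le S x z -> weak_le S y z -> weak_le S j z}].

Definition meet_in (J : {set W}) x y m :=
  [/\ weak_le S m x, weak_le S m y
    & {in <<J>>, forall z, weak_le S z x -> weak_le S z y -> weak_le S z m}].

(** An upper bound [z] in [W] lies above [u], so [u^-1 * z] lies above [x] and [y]; so does its
    projection to [<<J>>], where [j] is least. *)
Lemma join_translate (J : {set W}) u x y j : J \subset S -> ascents_in J u ->
  x \in <<J>> -> y \in <<J>> -> j \in <<J>> ->
  join_in J x y j -> is_join S (u * x) (u * y) (u * j).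
Proof.
move=> sJS asc Jx Jy Jj [xj yj min].
split; rewrite ?(ascents_weak_le sJS asc) // => z xz yz.
have uz : weak_le S u z := weak_le_trans (ascents_le sJS asc Jx) xz.
have in_u p : p \in <<J>> ->
    weak_le S (u * p) z = weak_le S p (u^-1 * z).
  move=> Jp; move: uz; rewrite !weak_leE (ascents_length sJS asc) //.
  by rewrite invMg mulgA; cox_lia.
rewrite in_u // in xz; rewrite in_u // in yz; rewrite in_u //.
have [zJ [Jz zJz max]] := parabolic_projection (u^-1 * z) sJS.
by apply: (weak_le_trans _ zJz); apply: min; rewrite ?max.
Qed.

(** Dual to joins: left multiplication by [w0] reverses the order of [W], that by [wJ] the order of
    [<<J>>], and together they carry this coset to another one, where the meet becomes a join. *)
Lemma meet_translate (J : {set W}) u x y m : J \subset S -> ascents_in J u ->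
  x \in <<J>> -> y \in <<J>> -> m \in <<J>> ->
  meet_in J x y m -> is_meet S (u * x) (u * y) (u * m).
Proof.
move=> sJS asc Jx Jy Jm [mx my max].
have flip (K : {set W}) w p q : K \subset S ->
    {in <<K>>, forall a, l w = l (w * a) + l a} -> p \in <<K>> -> q \in <<K>> ->
    weak_le S (w * p) (w * q) = weak_le S q p.
  move=> sKS long Kp Kq; rewrite !weak_leE invMg -mulgA mulKg.
  have := long _ Kp; have := long _ Kq; rewrite -[l (p^-1 * q)]lengthV invMg invgK.
  by cox_lia.
have [w0 _ long0] := longest_exists (subxx S).
have flip0 p q : weak_le S (w0 * p) (w0 * q) = weak_le S q p.
  by apply: (flip _ _ _ _ (subxx S) long0); apply: cox_gen.
have [wJ JwJ longJ] := longest_exists sJS.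
have wJ2 : wJ * wJ = 1.
  by apply: length_eq0; have := longJ _ JwJ; cox_lia.
have wJV : wJ^-1 = wJ by apply/eqP; rewrite eq_invg_mul wJ2.
(* [u * wJ] is the top of its coset, so [w0] sends it to the minimal element of the image. *)
have ascJ : ascents_in J (w0 * u * wJ).
  move=> s Js /=; have Jws : wJ * s \in <<J>> by rewrite groupM // mem_gen.
  have := long0 (u * wJ) (cox_gen _); have := long0 (u * (wJ * s)) (cox_gen _).
  have := longJ _ (mem_gen Js); rewrite -!mulgA !(ascents_length sJS asc) //.
  by rewrite (length_gen (subsetP sJS _ Js)); cox_lia.
have w0E p : w0 * (u * p) = w0 * u * wJ * (wJ * p).
  by rewrite -!mulgA [wJ * (wJ * p)]mulgA wJ2 mul1g.
split; rewrite ?(ascents_weak_le sJS asc) // => z zx zy.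
rewrite -flip0; have [] // := @join_translate J (w0 * u * wJ) (wJ * x) (wJ * y) (wJ * m).
- by rewrite groupM.
- by rewrite groupM.
- by rewrite groupM.
- split; rewrite ?(flip J) // => p Jp; rewrite -[p](mulKVg wJ) wJV.
  have Jwp : wJ * p \in <<J>> by rewrite groupM.
  by rewrite !(flip J) //; apply: max.
by move=> _ _; rewrite -!w0E; apply; rewrite flip0.
Qed.

(** * Parity of the length and counting by ascents *)

Lemma odd_lengthM x y : odd (l (x * y)) = odd (l x) (+) odd (l y).
Proof.
have odds u s : s \in S -> odd (l (u * s)) = ~~ odd (l u).
  by move=> Ss; case/orP: (length_mulsP u Ss) => /eqP-> //=; rewrite negbK.
have oddw c : word S c -> odd (l (x * wprod c)) = odd (l x) (+) odd (l (wprod c)).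
  elim/last_ind: c => [_|c s IH]; first by rewrite wprod_nil mulg1 length1 addbF.
  have -> : x * wprod (rcons c s) = x * wprod c * s.
    by rewrite wprod_rcons mulgA.
  rewrite all_rcons wprod_rcons => /andP[/= Ss /IH eq_c].
  by rewrite !(odds _ s) // eq_c addbN.
by have [c [Sc _ ->]] := length_word y; apply: oddw.
Qed.

(** The rotations [<[a * b]>] are normalized by [a]. They have even length and [a] has odd length,
    so they meet [<[a]>] trivially. *)
Lemma dihedral_card a b : a \in S -> b \in S ->
  #|<<[set a; b]>>| = (2 * #[a * b])%N.
Proof.
move=> Sa Sb; have [_ ord2 _] := coxW.
have ba : b = a * (a * b) by rewrite mulgA cox_invol // mul1g.
have -> : <<[set a; b]>> = <[a]> <*> <[a * b]>.
  apply/eqP; rewrite eqEsubset; apply/andP; split; last first.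
    by rewrite join_subG !cycle_subG groupM mem_gen // !inE eqxx ?orbT.
  have aG : a \in <[a]> <*> <[a * b]> by rewrite mem_gen // inE cycle_id.
  rewrite gen_subG subUset !sub1set aG {1}ba groupM //.
  by rewrite mem_gen // inE cycle_id orbT.
have nab : <[a]> \subset 'N(<[a * b]>).
  rewrite cycle_subG; apply/normP; rewrite -cycleJ.
  have -> : (a * b) ^ a = (a * b)^-1.
    by rewrite conjgE invMg !cox_invV // !mulgA cox_invol // mul1g.
  exact: cycleV.
rewrite norm_joinEl // TI_cardMg; first by rewrite -!orderE ord2.
apply/trivgP/subsetP=> x /setIP[ax /cycleP[k x_def]]; rewrite inE.
have ev : odd (l x) = false.
  rewrite x_def; elim: k {x_def} => [|k IH]; first by rewrite expg0 length1.
  by rewrite expgS odd_lengthM IH odd_lengthM !length_gen.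
have : x \in [set 1; a] by rewrite -cycle2g ?ord2.
by case/set2P=> x1; [rewrite x1 | move: ev; rewrite x1 length_gen].
Qed.

(** Each coset of [<<K>>] in [<<J>>] has exactly one element whose ascents include [K]. *)
Lemma ascents_card (K J : {set W}) : K \subset J -> J \subset S ->
  (#|[set w in <<J>> | [forall s in K, l w < l (w * s)]]| * #|<<K>>|)%N = #|<<J>>|.
Proof.
move=> sKJ sJS; have sKS := subset_trans sKJ sJS; set D := [set w in _ | _].
have sKJg : <<K>> \subset <<J>> by apply: genS.
have DP w : reflect (w \in <<J>> /\ ascents_in K w) (w \in D).
  rewrite inE; apply: (iffP andP) => -[Jw asc]; split=> //.
    by move=> s Ks; apply: (forall_inP asc).
  by apply/forall_inP.
rewrite -(LagrangeI <<J>>%G <<K>>%G) (setIidPr sKJg) mulnC; congr (_ * _)%N.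
have inj : {in D &, injective (fun w => w *: <<K>>)}.
  move=> u v /DP[_ ascu] /DP[_ ascv] eqA.
  have /lcosetP[y Ky v_def] : v \in u *: <<K>> by rewrite eqA lcoset_refl.
  have := ascents_length sKS ascu Ky.
  have := ascents_length sKS ascv (groupVr Ky).
  rewrite v_def mulgK lengthV => le1 le2.
  by have -> : y = 1 by [apply: length_eq0; cox_lia]; rewrite mulg1.
rewrite -(card_in_imset inj) -card_lcosets; congr #|pred_of_set _|.
apply/setP=> A; apply/imsetP/lcosetsP=> -[w].
  by case/DP=> Jw _ ->; exists w.
move=> Jw ->; have [u [x [asc Kx w_def]]] := ascents_coset sKS w.
have eqA : w *: <<K>> = u *: <<K>>.
  by apply/lcoset_eqP; rewrite w_def mem_lcoset mulKg.
exists u => //; apply/DP; split=> //.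
by rewrite -[u](mulgK x) -w_def groupM // groupV (subsetP sKJg).
Qed.

(** Inclusion-exclusion for the three ascent sets [A s], each of size g/2. Only 1 lies in all of
    them, and only the longest element in none; [p], [q], [r] are the sizes of the pairwise
    intersections. *)
Lemma rank3_card (a b c : W) : a \in S -> b \in S -> c \in S ->
  let g := #|<<[set a; b; c]>>| in
  exists p q r : nat,
    [/\ (g + 4 = 2 * (p + q + r))%N, (2 * #[a * b] * p = g)%N,
        (2 * #[a * c] * q = g)%N & (2 * #[b * c] * r = g)%N].
Proof.
move=> Sa Sb Sc; set J := [set a; b; c] => g.
have sJS : J \subset S by rewrite !subUset !sub1set Sa Sb Sc.
pose A s := [set w in <<J>> | l w < l (w * s)].
have cardA (s : W) : s \in J -> (#|A s| * 2)%N = g.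
  move=> Js; have sJ : [set s] \subset J by rewrite sub1set.
  rewrite -[RHS](ascents_card sJ sJS); congr (_ * _)%N; last first.
    by have [_ ord2 _] := coxW; rewrite -(ord2 s) ?(subsetP sJS).
  apply: eq_card => w; rewrite !inE; congr (_ && _).
  by apply/idP/forall_inP => [lt t /set1P-> //|]; apply; rewrite set11.
have cardAA (s t : W) : s \in J -> t \in J -> (2 * #[s * t] * #|A s :&: A t|)%N = g.
  move=> Js Jt; have sJ : [set s; t] \subset J by rewrite subUset !sub1set Js.
  rewrite -[RHS](ascents_card sJ sJS) dihedral_card ?(subsetP sJS) //.
  rewrite mulnC [(2 * _)%N]mulnC; congr (_ * _)%N.
  apply: eq_card => w; rewrite !inE andbACA andbb; congr (_ && _).
  apply/andP/forall_inP => [[lts ltt] z /set2P[]-> //|asc].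
  by rewrite !asc // !inE eqxx ?orbT.
have [Ja Jb Jc] : [/\ a \in J, b \in J & c \in J] by rewrite !inE !eqxx !orbT.
have ascP w : reflect (ascents_in J w) [&& l w < l (w * a), l w < l (w * b) & l w < l (w * c)].
  apply: (iffP and3P) => [[lta ltb ltc] s|asc]; last by split; apply: asc.
  by rewrite !inE -orbA => /or3P[]/eqP->.
have card3 : #|A a :&: A b :&: A c| = 1%N.
  apply/eqP/cards1P; exists 1; apply/setP=> w; rewrite !inE.
  apply/idP/eqP => [|->]; last first.
    by rewrite group1 !mul1g length1 !length_gen.
  case/andP=> /andP[/andP[Jw lta] /andP[_ ltb]] /andP[_ ltc].
  have /ascP asc : [&& l w < l (w * a), l w < l (w * b) & l w < l (w * c)] by apply/and3P.
  have := ascents_length sJS asc (groupVr Jw).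
  by rewrite mulgV length1 => eq0; apply: length_eq0; cox_lia.
have cardD : (#|A a :|: A b :|: A c|.+1 = g)%N.
  have [wJ JwJ long] := longest_exists sJS.
  have sub : A a :|: A b :|: A c \subset <<J>>.
    by apply/subsetP=> w; rewrite !inE => /orP[/orP[]|] /andP[].
  have -> : A a :|: A b :|: A c = <<J>> :\ wJ.
    apply/setP=> w; rewrite in_setD1; apply/idP/idP.
      have not_asc s : s \in J -> l wJ < l (wJ * s) -> False.
        move=> Js; have := long _ (mem_gen Js).
        by rewrite (length_gen (subsetP sJS _ Js)); cox_lia.
      move=> Aw; rewrite (subsetP sub) // andbT; apply: contraTneq Aw => ->.
      by rewrite !inE -!andb_orr; apply/negP=> /andP[_ /orP[/orP[]|]]; apply: not_asc.
    case/andP=> neq Jw; move: neq; apply: contraR; rewrite !inE Jw /= !negb_or -!leqNgt.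
    case/andP=> /andP[dea deb] dec.
    have desc : {in J, forall s, l (w * s) <= l w}.
      by move=> s; rewrite !inE -orbA => /or3P[]/eqP->.
    rewrite eq_mulgV1; apply/eqP/length_eq0.
    have := descents_length sJS desc JwJ.
    by have := long _ Jw; cox_lia.
  by rewrite [g](cardsD1 wJ) JwJ.
exists #|A a :&: A b|, #|A a :&: A c|, #|A b :&: A c|; split; rewrite ?cardAA //.
have := cardsUI (A a) (A b); have := cardsUI (A a :|: A b) (A c).
(* In total, g - 1 = 3g/2 - (p + q + r) + 1. *)
have := cardsUI (A a :&: A c) (A b :&: A c).
rewrite -setIUl setIACA setIid card3.
by have := cardA _ Ja; have := cardA _ Jb; have := cardA _ Jc; lia.
Qed.

(** * Generation in rank three *)

Definition closed_in (J : {set W}) (Y : W -> Prop) :=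
  (forall x y j, x \in <<J>> -> y \in <<J>> -> j \in <<J>> ->
     Y x -> Y y -> join_in J x y j -> Y j) /\
  (forall x y m, x \in <<J>> -> y \in <<J>> -> m \in <<J>> ->
     Y x -> Y y -> meet_in J x y m -> Y m).

Section CayleyGeneration.

Variables (gs : seq W) (T : seq (seq nat)) (M : nat -> nat -> nat).

Let gen i := nth 1 gs i.
Let J := [set s in gs].
Let n := size T.

Hypothesis size_gs : size gs = 3.
Hypothesis sJS : J \subset S.
Hypothesis genM : forall i j, i < 3 -> j < 3 -> (gen i * gen j) ^+ M i j = 1.
Hypothesis cardJ : #|<<J>>| = n.

Let words := state_words T.
Let lev := [seq size e | e <- words].

Hypothesis n_gt0 : 0 < n.
Hypothesis cayleyT : cayley_ok T M lev.

(** The element that state [i] is meant to represent. By [phi_step], [phi_surj] and [phi_inj] below,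
    it identifies the table with the Cayley graph of [<<J>>]. *)
Let phi i := wprod [seq gen a | a <- state_word T n i].

Let genJ i : i < 3 -> gen i \in J.
Proof. by move=> lt_i; rewrite inE mem_nth ?size_gs. Qed.

Let genS i : i < 3 -> gen i \in S.
Proof. by move/genJ; apply: (subsetP sJS). Qed.

Fixpoint alternating s t k : W :=
  if k is k'.+1 then alternating t s k' * s else 1.

(** Compares the two sides of a polygon: they have equal products once the braid relation makes the
    right-hand side trivial. *)
Lemma alternatingV s t k : s \in S -> t \in S ->
  (alternating t s k)^-1 * alternating s t k = (t * s) ^+ k.
Proof.
elim: k s t => [|k IH] s t Ss St /=; first by rewrite invg1 mulg1.
rewrite invMg cox_invV // mulgA -(mulgA t) IH //.
elim: k {IH} => [|k IH]; first by rewrite mulg1.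
by rewrite expgS [RHS]expgS -IH !mulgA.
Qed.

Let step_lt i a : i < n -> a < 3 -> step T i a < n.
Proof.
case/andP: cayleyT => /allP okT _ lt_i lt_a.
have /okT/allP okTi : i \in iota 0 n by rewrite mem_iota.
by have /okTi/and4P[] : a \in iota 0 3 by rewrite mem_iota.
Qed.

Let stepK i a : i < n -> a < 3 -> step T (step T i a) a = i.
Proof.
case/andP: cayleyT => /allP okT _ lt_i lt_a.
have /okT/allP okTi : i \in iota 0 n by rewrite mem_iota.
by have /okTi/and4P[_ /eqP] : a \in iota 0 3 by rewrite mem_iota.
Qed.

Let step_neq i a : i < n -> a < 3 -> step T i a != i.
Proof.
case/andP: cayleyT => /allP okT _ lt_i lt_a.
have /okT/allP okTi : i \in iota 0 n by rewrite mem_iota.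
by have /okTi/and4P[] : a \in iota 0 3 by rewrite mem_iota.
Qed.

Let lev_step i a : i < n -> a < 3 -> nth 0 lev (step T i a) <= (nth 0 lev i).+1.
Proof.
case/andP: cayleyT => /allP okT _ lt_i lt_a.
have /okT/allP okTi : i \in iota 0 n by rewrite mem_iota.
by have /okTi/and4P[] : a \in iota 0 3 by rewrite mem_iota.
Qed.

Let braid i : 0 < i < n ->
  [/\ first_descent T i < 3, step T i (first_descent T i) < i &
    forall b, b < 3 -> step T i b < i -> b != first_descent T i ->
    let a := first_descent T i in
    [/\ 0 < M a b, descending T i a b (M a b), descending T i b a (M a b)
      & alternate T i a b (M a b) = alternate T i b a (M a b)]].
Proof.
case/andP: cayleyT => _ /allP ok /andP[i_gt0 lt_i].
have /ok/and3P[lt_a dec_a /allP okb] : i \in iota 1 n.-1.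
  by rewrite mem_iota i_gt0 add1n prednK.
split=> // b lt_b dec_b ba; have /okb : b \in iota 0 3 by rewrite mem_iota.
by rewrite dec_b ba => /and4P[? ? ? /eqP].
Qed.

Let state_word_fuel k k' i : i < k -> i < k' -> i < n ->
  state_word T k i = state_word T k' i.
Proof.
elim: k k' i => // k IH [|k'] // i lt_k lt_k' lt_n /=.
have [//|i_neq0] := eqVneq i 0%N.
have [|_ dec _] := @braid i; first by rewrite lt0n i_neq0.
by congr (rcons _ _); apply: IH; lia.
Qed.

Let phi0 : phi 0 = 1.
Proof. by rewrite /phi; case: n n_gt0 => //= *; rewrite wprod_nil. Qed.

Let words_nth i : i < n -> nth [::] words i = state_word T n i.
Proof. by move=> lt_i; rewrite (nth_map 0) ?size_iota // nth_iota. Qed.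

Let lev_nth i : i < n -> nth 0 lev i = size (state_word T n i).
Proof.
by move=> lt_i; rewrite (nth_map [::]) ?words_nth // size_map size_iota.
Qed.

Let state_wordE i : 0 < i < n -> state_word T n i =
  rcons (state_word T n (step T i (first_descent T i))) (first_descent T i).
Proof.
move=> lt_i; have [_ dec _] := braid lt_i; case/andP: lt_i => i_gt0 lt_i.
rewrite (@state_word_fuel n n.+1) /= ?ltnS ?(ltnW lt_i) //.
by rewrite eqn0Ngt i_gt0.
Qed.

Let phi_first_descent i : 0 < i < n ->
  phi i = phi (step T i (first_descent T i)) * gen (first_descent T i).
Proof. by move=> lt_i; rewrite {1}/phi state_wordE // map_rcons wprod_rcons. Qed.

Let phi_walk k i a b : i < n -> a < 3 -> b < 3 ->
    (forall j c : nat, j <= i -> c < 3 -> step T j c < j ->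
       phi j = phi (step T j c) * gen c) ->
  descending T i a b k ->
  phi i = phi (alternate T i a b k) * alternating (gen a) (gen b) k.
Proof.
elim: k i a b => [|k IH] i a b lt_i lt_a lt_b law /=; first by rewrite mulg1.
case/andP=> dec desc; rewrite (law i a) // mulgA -IH // ?step_lt // => j c le_j.
by apply: law; apply: leq_trans le_j (ltnW dec).
Qed.

(* All edges of a polygon but the one along [gen a] at its top [i] are known, by
   induction, to be labelled correctly; the braid relation gives the last one. *)
Let phi_descent i a : i < n -> a < 3 -> step T i a < i ->
  phi i = phi (step T i a) * gen a.
Proof.
elim/ltn_ind: i a => i IH b lt_i lt_b dec_b.
have lt_i0 : 0 < i < n by rewrite lt_i (leq_ltn_trans (leq0n _) dec_b).
have [lt_a dec_a braidb] := braid lt_i0; move: (phi_first_descent lt_i0).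
have [<- //|ba] := eqVneq b (first_descent T i).
have := braidb b lt_b dec_b ba; rewrite /=.
set a := first_descent T i in lt_a dec_a braidb *.
have := genM lt_a lt_b; case: (M a b) => [|k]; first by move=> _ [].
move=> ab1 [_ /= /andP[_ desc_a] /andP[_ desc_b] eq_u] ->.
have law j : j < i -> forall j' c : nat, j' <= j -> c < 3 -> step T j' c < j' ->
    phi j' = phi (step T j' c) * gen c.
  move=> lt_j j' c le_j' lt_c; apply: IH => //; apply: (leq_ltn_trans le_j') => //.
  exact: ltn_trans lt_i.
rewrite (phi_walk _ _ _ (law _ dec_a) desc_a) ?step_lt //.
rewrite (phi_walk _ _ _ (law _ dec_b) desc_b) ?step_lt // -eq_u -!mulgA.
congr (_ * _); apply/eqP; rewrite eq_mulVg1; apply/eqP.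
exact: etrans (alternatingV k.+1 (genS lt_b) (genS lt_a)) ab1.
Qed.

Let phi_step i a : i < n -> a < 3 -> phi (step T i a) = phi i * gen a.
Proof.
move=> lt_i lt_a; have := step_neq lt_i lt_a; rewrite neq_ltn => /orP[dec|asc].
  by rewrite (phi_descent lt_i lt_a dec) mulsK // genS.
by rewrite (phi_descent (step_lt lt_i lt_a) lt_a) stepK.
Qed.

Let run_lt (d : seq nat) i : i < n -> all (ltn^~ 3) d -> run T i d < n.
Proof.
elim: d i => //= a d IH i lt_i /andP[lt_a lt_d]; rewrite /run /=.
by apply: IH => //; apply: step_lt.
Qed.

Let phi_run (d : seq nat) i : i < n -> all (ltn^~ 3) d ->
  phi (run T i d) = phi i * wprod [seq gen a | a <- d].
Proof.
elim: d i => [|a d IH] i lt_i /=; first by rewrite wprod_nil mulg1.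
case/andP=> lt_a lt_d; rewrite /run /= IH ?step_lt // phi_step //.
by rewrite wprod_cons mulgA.
Qed.

Let state_word_lt3 k i : i < n -> all (ltn^~ 3) (state_word T k i).
Proof.
elim: k i => //= k IH i lt_i; have [//|i_neq0] := eqVneq i 0%N.
have [|lt3 dec _] := @braid i; first by rewrite lt0n i_neq0.
by rewrite all_rcons /= lt3 IH // (ltn_trans dec).
Qed.

Let phiJ i : i < n -> phi i \in <<J>>.
Proof.
move=> lt_i; apply: wprod_gen; rewrite all_map.
by apply: sub_all (state_word_lt3 n lt_i) => a; apply: genJ.
Qed.

Let letters c : all (mem J) c ->
  exists d : seq nat, [/\ all (ltn^~ 3) d, size d = size c & c = [seq gen a | a <- d]].
Proof.
elim: c => [|s c IH] /=; first by exists [::].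
case/andP; rewrite inE => s_gs /IH[d [lt_d sz_d ->]].
exists (index s gs :: d); rewrite /= sz_d lt_d /gen nth_index //.
by rewrite andbT -size_gs index_mem size_map sz_d.
Qed.

Let phi_surj x : x \in <<J>> -> exists2 i, i < n & phi i = x.
Proof.
case/gen_wprod=> c /letters[d [lt_d _ ->]] ->.
by exists (run T 0 d); rewrite ?run_lt // phi_run // phi0 mul1g.
Qed.

(** A surjection from [n] states onto a group of [n] elements is injective; this is where the
    cardinality of [<<J>>] enters. *)
Let phi_inj i j : i < n -> j < n -> phi i = phi j -> i = j.
Proof.
pose s := [seq phi i | i <- iota 0 n] => lt_i lt_j eq_ij.
have uniq_s : uniq s.
  apply: (leq_size_uniq (enum_uniq (mem <<J>>))) => [x|].
    rewrite mem_enum => /phi_surj[k lt_k <-]; apply: map_f.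
    by rewrite mem_iota.
  by rewrite size_map size_iota -cardE cardJ.
apply/eqP; rewrite -(nth_uniq 1 _ _ uniq_s) ?size_map ?size_iota //.
by rewrite !(nth_map 0) ?size_iota // !nth_iota // !add0n eq_ij.
Qed.

(** A reduced word of [phi i] leads from state 0 to [i], and [lev] rises by at most one at each
    letter, so the state word is already shortest. *)
Let length_phi i : i < n -> l (phi i) = nth 0 lev i.
Proof.
move=> lt_i; apply/eqP; rewrite eqn_leq lev_nth //; apply/andP; split.
  rewrite -(size_map gen); apply: length_le; rewrite all_map.
  by apply: sub_all (state_word_lt3 n lt_i) => a; apply: genS.
have [c [Jc <- phi_c]] := reduced_word sJS (phiJ lt_i).
have [d [lt_d <- c_def]] := letters Jc.
have -> : i = run T 0 d.
  by apply: phi_inj; rewrite ?run_lt // phi_run // phi0 mul1g -c_def.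
rewrite -lev_nth ?run_lt //; elim/last_ind: d lt_d {c_def} => [|d a IH].
  by rewrite lev_nth // /run /=; case: n n_gt0.
rewrite all_rcons size_rcons => /andP[lt_a lt_d].
rewrite /run foldl_rcons (leq_trans (lev_step _ _)) ?run_lt //.
by rewrite ltnS IH.
Qed.

Let A := order_matrix T words lev.

Let size_words : size words = n.
Proof. by rewrite size_map size_iota. Qed.

Let A_le i j : i < n -> j < n ->
  nth false (nth [::] A i) j = weak_le S (phi i) (phi j).
Proof.
move=> lt_i lt_j; rewrite (nth_map [::]) ?size_words //.
rewrite (nth_map [::]) ?size_words // weak_leE !words_nth //.
rewrite (length_phi lt_i) (length_phi lt_j) (lev_nth lt_i) (lev_nth lt_j).
congr (_ == _ + _)%N.
have lt3 k : k < n -> all (ltn^~ 3) (rev (state_word T n k)).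
  by move=> lt_k; rewrite all_rev state_word_lt3.
have lt_r := run_lt n_gt0 (lt3 i lt_i).
rewrite -(length_phi (run_lt lt_r (state_word_lt3 n lt_j))).
rewrite (phi_run lt_r (state_word_lt3 n lt_j)) (phi_run n_gt0 (lt3 _ lt_i)).
rewrite phi0 mul1g map_rev wprodV //.
rewrite all_map; apply: sub_all (state_word_lt3 n lt_i) => a; exact: genS.
Qed.

Let size_A i : i < n -> size (nth [::] A i) = n.
Proof. by move=> lt_i; rewrite (nth_map [::]) ?size_words // size_map size_words. Qed.

Let At := transposed T A.

Let At_le i j : i < n -> j < n ->
  nth false (nth [::] At i) j = weak_le S (phi j) (phi i).
Proof.
move=> lt_i lt_j; rewrite (nth_map 0) ?size_iota // nth_iota // add0n.
by rewrite (nth_map [::]) ?size_map ?size_iota // A_le.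
Qed.

Let size_At i : i < n -> size (nth [::] At i) = n.
Proof.
by move=> lt_i; rewrite (nth_map 0) ?size_iota // !size_map size_iota.
Qed.

(** [R] stands for the weak order when [B] is [A], and for its reverse when [B] is [At], so that one
    argument serves joins and meets. *)
Let bound_okP (B : seq bitseq) (R : rel W) i j k :
  (forall i, i < n -> size (nth [::] B i) = n) ->
  (forall i j, i < n -> j < n -> nth false (nth [::] B i) j = R (phi i) (phi j)) ->
  i < n -> j < n -> k < n -> bound_ok B i j k ->
  [/\ R (phi i) (phi k), R (phi j) (phi k) &
    {in <<J>>, forall z, R (phi i) z -> R (phi j) z -> R (phi k) z}].
Proof.
move=> szB BR lt_i lt_j lt_k /and3P[]; rewrite !BR // => ik jk /allP ub.
split=> // z /phi_surj[u lt_u <-]; rewrite -!BR // => iu ju.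
have := ub (true, true, nth false (nth [::] B k) u); apply => //.
have sz_z : size (zip (nth [::] B i) (nth [::] B j)) = n.
  by rewrite size_zip !szB // minnn.
rewrite -[X in (X, _, _)]iu -[X in (_, X, _)]ju -(nth_zip false false) ?szB //.
rewrite -nth_zip ?sz_z ?szB // mem_nth // size_zip sz_z szB // minnn //.
Qed.

Variable Y : W -> Prop.
Hypothesis closedY : closed_in J Y.
Hypothesis Y_rank2 : {in J, forall s, {in <<J :\ s>>, forall x, Y x}}.
Hypothesis uniq_gs : uniq gs.

Let steps_generate known steps :
  (forall i, i \in known -> i < n /\ Y (phi i)) ->
  steps_ok T A At known steps -> {in <<J>>, forall x, Y x}.
Proof.
elim: steps known => [|[b [[i j] k]] steps IH] known Yk /=.
  move/allP=> all_k x /phi_surj[i lt_i <-].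
  by have [] // := Yk i; apply: all_k; rewrite mem_iota.
case/and5P=> /Yk[lt_i Yi] /Yk[lt_j Yj] lt_k ok; apply: IH => u.
rewrite inE => /predU1P[-> {u}|]; last exact: Yk.
split=> //; case: b ok => ok.
  apply: (closedY.1 _ _ _ (phiJ lt_i) (phiJ lt_j) (phiJ lt_k) Yi Yj).
  exact: (bound_okP size_A A_le).
apply: (closedY.2 _ _ _ (phiJ lt_i) (phiJ lt_j) (phiJ lt_k) Yi Yj).
exact: (bound_okP (R := fun x y => weak_le S y x) size_At At_le).
Qed.

Let rank2_states_Y i : i \in rank2_states T words -> i < n /\ Y (phi i).
Proof.
rewrite mem_filter mem_iota => /andP[/hasP[a]]; rewrite mem_iota => /= lt_a a_i lt_i.
split=> //; apply: (Y_rank2 (genJ lt_a)); apply: wprod_gen; rewrite all_map.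
apply/allP=> b b_i /=; have lt_b := allP (state_word_lt3 n lt_i) b b_i.
rewrite !inE mem_nth ?size_gs // andbT nth_uniq ?size_gs //.
by apply: contraNneq a_i => <-; rewrite words_nth.
Qed.

Lemma cayley_generation steps :
  steps_ok T A At (rank2_states T words) steps -> {in <<J>>, forall x, Y x}.
Proof. exact/steps_generate/rank2_states_Y. Qed.

End CayleyGeneration.

(** The orders supply the relations for labelling the table, and the cardinality makes the labelling
    bijective. *)
Lemma rank3_path (J : {set W}) (Y : W -> Prop) (a b c : W) m T steps :
    J = [set s in [:: a; b; c]] -> J \subset S -> uniq [:: a; b; c] ->
    #[a * b] = 3 -> #[a * c] = 2 -> #[b * c] = m -> #|<<J>>| = size T ->
    generation_ok T (path_matrix m) steps ->
  closed_in J Y -> {in J, forall s, {in <<J :\ s>>, forall x, Y x}} ->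
  {in <<J>>, forall x, Y x}.
Proof.
move=> -> sJS uniq_abc ab ac bc cardT /and3P[T_gt0 okT ok_steps] closedY Y2.
have [Sa Sb Sc] : [/\ a \in S, b \in S & c \in S].
  by split; apply: (subsetP sJS); rewrite !inE eqxx ?orbT.
have comm_order (s t : W) : s \in S -> t \in S -> #[s * t] = #[t * s].
  by move=> Ss St; rewrite -orderV invMg !cox_invV.
apply: (cayley_generation _ sJS _ cardT T_gt0 okT closedY Y2 uniq_abc ok_steps) => // i j.
by case: i j => [|[|[|i]]] // [|[|[|j]]] // _ _; rewrite /path_matrix /=
  ?cox_invol ?expg1 // -?ab -?ac -?bc ?expg_order //;
  rewrite comm_order ?expg_order.
Qed.

(** As [c] commutes with [a] and [b], every element is [p] or [p * c] with [p] generated by [a] and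
    [b], and [p * c] is the join of [p] and [c]. *)
Lemma rank3_prism (J : {set W}) (Y : W -> Prop) (a b c : W) :
    J = [set s in [:: a; b; c]] -> J \subset S -> uniq [:: a; b; c] ->
    #[a * c] = 2 -> #[b * c] = 2 ->
  closed_in J Y -> {in J, forall s, {in <<J :\ s>>, forall x, Y x}} ->
  {in <<J>>, forall x, Y x}.
Proof.
move=> J_def sJS uniq_abc ac bc [Y_join _] Y2.
have [Ja Jb Jc] : [/\ a \in J, b \in J & c \in J].
  by rewrite J_def !inE !eqxx ?orbT.
have [Sa Sb Sc] : [/\ a \in S, b \in S & c \in S] by rewrite !(subsetP sJS).
set K := J :\ c; have sKJ : K \subset J by apply: subsetDl.
have K_def : K = [set a; b].
  apply/setP=> s; rewrite !inE J_def !inE.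
  move: uniq_abc; rewrite /= !inE negb_or => /and3P[/andP[ab ac'] bc' _].
  have [->|] := eqVneq s c; rewrite ?orbF // [c == a]eq_sym [c == b]eq_sym.
  by rewrite (negbTE ac') (negbTE bc').
have commute_c (s : W) : s \in S -> #[s * c] = 2 -> c * s = s * c.
  move=> Ss sc; have := expg_order (s * c); rewrite sc expgS expg1 => sc1.
  have : (s * c)^-1 = s * c by apply/eqP; rewrite eq_invg_mul sc1.
  by rewrite invMg !cox_invV.
have comm p : p \in <<K>> -> c * p = p * c.
  have sKC : K \subset 'C[c].
    by rewrite K_def subUset !sub1set !cent1E !commute_c // !eqxx.
  by rewrite -(gen_subG K) in sKC; move/(subsetP sKC)/cent1P.
(* Otherwise deletion would put [c] in [<<K>>], and a reduced word there of length one would make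
   [c] a member of [K]. *)
have len p : p \in <<K>> -> l (p * c) = (l p).+1.
  move=> Kp; apply/eqP; rewrite -length_muls_gt // ltnNge; apply/negP.
  have [d [Kd _ p_def]] := reduced_word (subset_trans sKJ sJS) Kp.
  rewrite p_def => /(deletion (word_sub (subset_trans sKJ sJS) Kd) Sc).
  case=> d1 [e [d2 [d_def prod_d]]].
  have : c \in <<K>>.
    rewrite -(groupMl _ Kp) p_def prod_d wprod_gen //.
    by move: Kd; rewrite d_def !all_cat /= => /and3P[-> _ ->].
  case/(reduced_word (subset_trans sKJ sJS)) => -[|s [|? ?]] [];
    rewrite ?(length_gen Sc) // /wprod big_seq1 /= => /andP[Ks _] _ cs.
  by move: Ks; rewrite -cs !inE eqxx.
have decomp x : x \in <<J>> -> x \in <<K>> \/ exists2 p, p \in <<K>> & x = p * c.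
  case/gen_wprod=> d Jd ->; elim/last_ind: d Jd => [|d s IH].
    by left; rewrite wprod_nil group1.
  rewrite all_rcons wprod_rcons => /andP[/= Js /IH{}IH].
  have [-> | sc] := eqVneq s c.
    case: IH => [Kp|[p Kp ->]]; last by left; rewrite mulsK.
    by right; exists (wprod d).
  have Ks : s \in <<K>> by rewrite mem_gen // !inE sc.
  case: IH => [Kp|[p Kp ->]]; first by left; rewrite groupM.
  by right; exists (p * s); rewrite ?groupM // -!mulgA comm.
have Yc : Y c.
  apply: (Y2 a Ja); rewrite mem_gen // !inE Jc andbT eq_sym.
  by move: uniq_abc; rewrite /= !inE negb_or => /and3P[/andP[]].
have sgKJ : <<K>> \subset <<J>> by apply: genS.
move=> x /decomp[Kx|[p Kp ->]]; first exact: (Y2 c Jc).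
have Jp := subsetP sgKJ p Kp.
have gJc : c \in <<J>> by rewrite mem_gen.
apply: (Y_join p c (p * c) Jp gJc (groupM Jp gJc) (Y2 c Jc p Kp) Yc).
split.
- by rewrite weak_leE mulKg len // (length_gen Sc) addn1.
- by rewrite weak_leE -comm // mulKg comm // len // (length_gen Sc).
(* No [z] in [<<K>>] lies above [c]. For [z = q * c] both comparisons reduce to [p] below [q]. *)
move=> z /decomp[Kz|[q Kq ->]].
  rewrite !weak_leE (cox_invV Sc) comm // len // (length_gen Sc); cox_lia.
rewrite !weak_leE invMg (cox_invV Sc) -!mulgA.
have Kpq : p^-1 * q \in <<K>> by rewrite groupM ?groupV.
have -> : c * (p^-1 * (q * c)) = p^-1 * q.
  by rewrite [p^-1 * _]mulgA -comm // mulgA cox_invol // mul1g.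
by rewrite [p^-1 * (q * c)]mulgA !len //; cox_lia.
Qed.

(** Once the generators are ordered so that the orders of their products increase, the numerical
    classification leaves only a prism or one of the three tabulated paths. *)
Lemma rank3_generation (J : {set W}) (Y : W -> Prop) :
    J \subset S -> #|J| = 3 -> closed_in J Y ->
    {in J, forall s, {in <<J :\ s>>, forall x, Y x}} ->
  {in <<J>>, forall x, Y x}.
Proof.
move=> sJS cardJ closedY Y2.
have [a [b [c [uniq_abc J_def]]]] : exists a b c : W,
    uniq [:: a; b; c] /\ J = [set s in [:: a; b; c]].
  have := enum_uniq (mem J); have := cardE (mem J); rewrite cardJ.
  have JE : J = [set s in enum J] by apply/setP=> s; rewrite inE mem_enum.
  by case: (enum J) JE => [|a [|b [|c [|? ?]]]] // JE _ uniq_J; exists a, b, c.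
have perm_def (s t u : W) : perm_eq [:: a; b; c] [:: s; t; u] ->
    J = [set x in [:: s; t; u]] /\ uniq [:: s; t; u].
  move=> eq_abc; split; last by rewrite -(perm_uniq eq_abc).
  by rewrite J_def; apply/setP=> x; rewrite !in_set (perm_mem eq_abc).
have [Sa Sb Sc] : [/\ a \in S, b \in S & c \in S].
  by split; apply: (subsetP sJS); rewrite J_def !inE eqxx ?orbT.
have comm_order (s t : W) : s \in S -> t \in S -> #[s * t] = #[t * s].
  by move=> Ss St; rewrite -orderV invMg !cox_invV.
have order_gt1 (s t : W) : s \in S -> t \in S -> s != t -> 1 < #[s * t].
  by move=> Ss St; rewrite order_gt1 -{2}(cox_invV St) -eq_mulgV1.
have path (s t u : W) : perm_eq [:: a; b; c] [:: s; t; u] ->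
    #[s * t] = 3 -> #[s * u] = 2 ->
    [\/ #[t * u] = 3 /\ #|<<J>>| = 24, #[t * u] = 4 /\ #|<<J>>| = 48
      | #[t * u] = 5 /\ #|<<J>>| = 120] -> {in <<J>>, forall x, Y x}.
  case/perm_def=> J_stu uniq_stu st su [] [tu gJ].
  - exact: (rank3_path J_stu sJS uniq_stu st su tu _ A3_ok closedY Y2).
  - exact: (rank3_path J_stu sJS uniq_stu st su tu _ B3_ok closedY Y2).
  exact: (rank3_path J_stu sJS uniq_stu st su tu _ H3_ok closedY Y2).
have prism (s t u : W) : perm_eq [:: a; b; c] [:: s; t; u] ->
    #[s * u] = 2 -> #[t * u] = 2 -> {in <<J>>, forall x, Y x}.
  case/perm_def=> J_stu uniq_stu su tu.
  exact: (rank3_prism J_stu sJS uniq_stu su tu closedY Y2).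
have sorted (s t u : W) : perm_eq [:: a; b; c] [:: s; t; u] ->
    #[s * u] <= #[s * t] -> #[s * t] <= #[t * u] -> {in <<J>>, forall x, Y x}.
  move=> perm_stu le1 le2; have [J_stu uniq_stu] := perm_def _ _ _ perm_stu.
  have [Js Jt Ju] : [/\ s \in J, t \in J & u \in J] by rewrite J_stu !inE !eqxx !orbT.
  have [Ss St Su] : [/\ s \in S, t \in S & u \in S] by rewrite !(subsetP sJS).
  have JE : [set s; t; u] = J by rewrite J_stu; apply/setP=> x; rewrite !inE orbA.
  have [p [q [r]]] := rank3_card Ss St Su; rewrite JE => -[euler pst qsu rtu].
  have [] // := @coxeter_triple_sorted #[s * u] #[s * t] #[t * u] #|<<J>>| q p r.
  - apply: order_gt1 => //; move: uniq_stu.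
    by rewrite /= !inE negb_or => /and3P[/andP[]].
  - by rewrite euler [(q + p)%N]addnC.
  (* If [s * t] also has order 2, then [s] commutes with both others and plays the part of [c] in
     the prism. *)
  move=> su [st|[st tu]]; last exact: path perm_stu st su tu.
  apply: (prism t u s); rewrite ?(comm_order t) ?(comm_order u) //.
  by rewrite (perm_trans perm_stu) // -[[:: t; u; s]]/(rcons [:: t; u] s) perm_sym perm_rcons.
have perms (s t u : W) : perm_eq [:: a; b; c] [:: s; t; u] ->
    perm_eq [:: a; b; c] [:: t; s; u] /\ perm_eq [:: a; b; c] [:: s; u; t].
  move=> eq_abc; split; apply: (perm_trans eq_abc).
    exact: permEl (perm_catCA [:: s] [:: t] [:: u]).
  by rewrite perm_cons; apply: permEl (perm_catC [:: t] [:: u]).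
have abc := perm_refl [:: a; b; c]; have [bac acb] := perms _ _ _ abc.
have [_ bca] := perms _ _ _ bac; have [cab _] := perms _ _ _ acb.
have [_ cba] := perms _ _ _ cab.
have [ba ca cb] : [/\ #[b * a] = #[a * b], #[c * a] = #[a * c] & #[c * b] = #[b * c]].
  by split; apply: comm_order.
have [le1|/ltnW le1] := leqP #[a * b] #[a * c];
  have [le2|/ltnW le2] := leqP #[a * c] #[b * c];
  have [le3|/ltnW le3] := leqP #[a * b] #[b * c].
all: by first [ by apply: (sorted _ _ _ abc); rewrite ?ba ?ca ?cb
  | by apply: (sorted _ _ _ acb); rewrite ?ba ?ca ?cb
  | by apply: (sorted _ _ _ bac); rewrite ?ba ?ca ?cb
  | by apply: (sorted _ _ _ bca); rewrite ?ba ?ca ?cb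
  | by apply: (sorted _ _ _ cab); rewrite ?ba ?ca ?cb
  | by apply: (sorted _ _ _ cba); rewrite ?ba ?ca ?cb ].
Qed.

(** * Generation in arbitrary rank *)

Lemma weak_generation (X : W -> Prop) :
    (forall x y m, X x -> X y -> is_meet S x y m -> X m) ->
    (forall x y j, X x -> X y -> is_join S x y j -> X j) ->
    1 < #|S| ->
    (forall r s, r \in S -> s \in S -> r != s -> {in <<[set r; s]>>, forall x, X x}) ->
  forall w, X w.
Proof.
move=> X_meet X_join S_gt1 X2.
have X_coset u (K : {set W}) : K \subset S -> #|K| = 2 -> ascents_in K u ->
    {in <<K>>, forall x, X (u * x)}.
  have [k] := ubnP (l u); elim: k => // k IH in u K *; rewrite ltnS => le_u sKS K2.
  have [c [Sc sz_c u_def]] := length_word u.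
  case/lastP: c => [|c r] in Sc sz_c u_def * => asc x Kx.
    have /eqP/cards2P[s [t [st K_def]]] := K2.
    rewrite u_def wprod_nil mul1g; move: Kx; rewrite K_def; apply: X2 => //.
      by rewrite (subsetP sKS) // K_def !inE eqxx.
    by rewrite (subsetP sKS) // K_def !inE eqxx orbT.
  move: Sc sz_c; rewrite all_rcons size_rcons => /andP[/= Sr Sc] sz_c.
  have ur : l (u * r) < l u.
    by rewrite u_def wprod_rcons mulsK // -wprod_rcons -u_def -sz_c ltnS length_le.
  (* The last letter [r] of a reduced word is a descent of [u], whereas all of [K] are ascents. *)
  have Kr : r \notin K by apply/negP=> /asc; rewrite ltnNge ltnW.
  pose J := r |: K; have sJS : J \subset S by rewrite subUset sub1set sKS andbT.
  have sKJ : K \subset J by apply: subsetUr.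
  have [v [j [ascv Jj u_vj]]] := ascents_coset sJS u.
  (* If [u] were itself minimal in its coset of [<<J>>], then [r] would be an ascent. *)
  have lt_vu : l v < l u.
    rewrite u_vj (ascents_length sJS ascv Jj) -[X in X < _]addn0 ltn_add2l lt0n.
    apply: contraTneq ur => /length_eq0 j1.
    by rewrite u_vj j1 mulg1 -leqNgt ltnW // ascv // !inE eqxx.
  suff XJ : {in <<J>>, forall y, X (v * y)}.
    by rewrite u_vj -mulgA; apply: XJ; rewrite groupM // (subsetP (genS sKJ)).
  have J3 : #|J| = 3 by rewrite cardsU1 Kr K2.
  (* Translation by [v] pulls [X] back to a predicate on [<<J>>] closed under its joins and meets;
     the induction hypothesis at the shorter [v] covers the rank-two subgroups. *)
  apply: (rank3_generation sJS J3).
    split=> [y z w Jy Jz Jw Xy Xz|y z w Jy Jz Jw Xy Xz].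
      by move/(join_translate sJS ascv Jy Jz Jw); apply: X_join.
    by move/(meet_translate sJS ascv Jy Jz Jw); apply: X_meet.
  move=> s Js; apply: IH; first exact: leq_trans lt_vu le_u.
  - by exact: subset_trans (subsetDl _ _) sJS.
  - by have := cardsD1 s J; rewrite Js J3 => -[].
  by move=> t /setD1P[_ Jt]; apply: ascv.
move=> w; have /card_gt1P[r [s [Sr Ss rs]]] := S_gt1.
have sKS : [set r; s] \subset S by rewrite subUset !sub1set Sr.
have [u [x [asc Kx ->]]] := ascents_coset sKS w.
by apply: (X_coset u _ sKS) => //; rewrite cards2 rs.
Qed.

Lemma weak_le1 x : weak_le S 1 x.
Proof. by rewrite weak_leE length1 invg1 mul1g. Qed.

End Length.

(** * Agreement of homomorphisms *)

Lemma lattice_hom_extremal (W W' : finGroupType) (S : {set W}) (S' : {set W'})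
    (f g : W -> W') : coxeter_system S -> coxeter_system S' ->
    weak_lattice_hom S S' f -> surjective f ->
    weak_lattice_hom S S' g -> surjective g ->
  (forall b, (forall x, weak_le S b x) -> f b = g b) /\
  (forall t, (forall x, weak_le S x t) -> f t = g t).
Proof.
move=> coxW coxW' [f_meet f_join] f_surj [g_meet g_join] g_surj; split=> b ext.
  (* The bottom is its own meet with any [x], so its image lies below every [h x], and these exhaust
     [W']. *)
  have below (h : W -> W') :
      (forall x y m, is_meet S x y m -> is_meet S' (h x) (h y) (h m)) ->
      surjective h -> forall y, weak_le S' (h b) y.
    move=> h_meet h_surj y; have [x <-] := h_surj y.
    by have [] // := h_meet b x b; split=> //; apply: weak_le_refl.
  by apply: (weak_le_anti coxW'); apply: below.
have above (h : W -> W') :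
    (forall x y j, is_join S x y j -> is_join S' (h x) (h y) (h j)) ->
    surjective h -> forall y, weak_le S' y (h b).
  move=> h_join h_surj y; have [x <-] := h_surj y.
  by have [] // := h_join b x b; split=> //; apply: weak_le_refl.
by apply: (weak_le_anti coxW'); apply: above.
Qed.

Theorem corollary1p8 (W W' : finGroupType) (S : {set W}) (S' : {set W'})
    (coxW : coxeter_system S) (coxW' : coxeter_system S')
    (f g : W -> W')
    (hom_f : weak_lattice_hom S S' f) (surj_f : surjective f)
    (hom_g : weak_lattice_hom S S' g) (surj_g : surjective g)
    (agree : forall r s : W, r \in S -> s \in S -> r != s ->
       {in <<[set r; s]>>, f =1 g}) :
  f =1 g.
Proof.
have [bot_eq top_eq] := lattice_hom_extremal coxW coxW' hom_f surj_f hom_g surj_g.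
have [f_meet f_join] := hom_f; have [g_meet g_join] := hom_g.
(* With at most one generator [agree] is vacuous, but [W] has at most two elements, each of them the
   bottom or the top of the order. *)
have [S_le1|S_gt1] := leqP #|S| 1.
  have f1 : f 1 = g 1 by apply: bot_eq; apply: weak_le1.
  move=> x; have [-> //|x_neq1] := eqVneq x 1.
  apply: top_eq => y; have [-> |y_neq1] := eqVneq y 1; first exact: weak_le1.
  suff -> : y = x by apply: weak_le_refl.
  have [S0|[s Ss]] := set_0Vmem S.
    by have := cox_gen coxW x; rewrite S0 gen0 inE (negbTE x_neq1).
  have S_s : S = [set s] by apply/esym/eqP; rewrite eqEcard sub1set Ss cards1.
  have [_ /(_ s Ss) os _] := coxW.
  have two z : z != 1 -> z = s.
    have := cox_gen coxW z; rewrite S_s -/<[s]> cycle2g // => /set2P[->|//].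
    by rewrite eqxx.
  by rewrite (two x x_neq1) (two y y_neq1).
apply: (weak_generation coxW (X := fun w => f w = g w) _ _ S_gt1 agree).
  move=> x y m fx fy xym; have := g_meet x y m xym; rewrite -fx -fy.
  exact: (is_meet_uniq coxW' (f_meet x y m xym)).
move=> x y j fx fy xyj; have := g_join x y j xyj; rewrite -fx -fy.
exact: (is_join_uniq coxW' (f_join x y j xyj)).
Qed.
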